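(* Let $p\ge2$ be an integer and $\alpha,\beta>0$ real numbers such that $$\min(4\beta,1)\,(p-1)p\,\alpha<1.$$ Let $\mu\in\mathcal{M}_{inv}$, let $\sigma:[0,1]^4\to\{-1,1\}$ be the corresponding function, and let $\bar\sigma(w,u,v)=\int_0^1\sigma(w,u,v,x)\,dx$. Then $$\bar\sigma(w,u,v)=\mathbb{E}_u\bar\sigma(w,u,v)\quad\text{for almost all } w,u,v\in[0,1],$$ where $\mathbb{E}_u$ denotes the expectation in $u$ only, with $u$ uniform on $[0,1]$ (i.e. $\mathbb{E}_u\bar\sigma(w,u,v)=\int_0^1\bar\sigma(w,u',v)\,du'$).
   Context: **The function $\theta$.** Let $(J_i)_{1\le i\le p}$ be independent random signs, $\mathbb{P}(J_i=\pm1)=1/2$, and $\theta(\sigma_1,\ldots,\sigma_p)=\log\bigl(1+(e^{-\beta}-1)\prod_{1\le i\le p}\frac{1+J_i\sigma_i}{2}\bigr)$ on $[-1,1]^p$. The functions $\theta_{k,i}$ and $\hat\theta_k$ below are i.i.d. copies of $\theta$ (defined with independent copies of the signs). **Arrays generated by $\sigma$.** Given a measurable $\sigma:[0,1]^4\to\{-1,1\}$, it generates the exchangeable array $s_i^\ell=\sigma(w,u_\ell,v_i,x_{i,\ell})$, $i,\ell\ge1$, where $w,(u_\ell),(v_i),(x_{i,\ell})$ are i.i.d. uniform on $[0,1]$. Also, for multi-indices, let $s_{i_1,\ldots,i_n}=\sigma(w,u,v_{i_1,\ldots,i_n},x_{i_1,\ldots,i_n})$ and $\hat s_{i_1,\ldots,i_n}=\sigma(w,u,\hat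 v_{i_1,\ldots,i_n},\hat x_{i_1,\ldots,i_n})$, where $w,u$ and all the $v,x,\hat v,\hat x$ variables are i.i.d. uniform on $[0,1]$. **Cavity equations.** Let $n,m,q\ge1$, $r\ge0$ be integers with $n\le m$, and let $C_1,\ldots,C_q\subseteq\{1,\ldots,m\}$; write $C_\ell^1=C_\ell\cap\{1,\ldots,n\}$ and $C_\ell^2=C_\ell\cap\{n+1,\ldots,m\}$. Let $(\pi_i(\alpha p))_{i\ge1}$ be i.i.d. Poisson random variables with mean $\alpha p$, independent of everything else, and for $\varepsilon\in\{-1,1\}$ let $$A_i(\varepsilon)=\sum_{k\le\pi_i(\alpha p)}\theta_{k,i}(s_{1,i,k},\ldots,s_{p-1,i,k},\varepsilon).$$ Let $\mathbb{E}'$ denote expectation in $u$ and in the sequences $x,\hat x$ only, and let $\mathrm{Av}$ denote the uniform average over signs $(\varepsilon_i)_{i\ge1}$ in $\{-1,1\}$. Define $$U_\ell=\mathbb{E}'\Bigl(\mathrm{Av}\Bigl(\prod_{i\in C_\ell^1}\varepsilon_i\exp\sum_{i\le n}A_i(\varepsilon_i)\Bigr)\prod_{i\in C_\ell^2}s_i\,\exp\sum_{k\le r}\hat\theta_k(\hat s_{1,k},\ldots,\hat s_{p,k})\Bigr),$$ $$V=\mathbb{E}'\Bigl(\mathrm{Av}\Bigl(\exp\sum_{i\le n}A_i(\varepsilon_i)\Bigr)\exp\sum_{k\le r}\hat\theta_k(\hat s_{1,k},\ldots,\hat s_{p,k})\Bigr).$$ The cavity equation for these parameters is $$\mathbb{E}\prod_{\ell\le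 q}\mathbb{E}'\prod_{i\in C_\ell}s_i=\mathbb{E}\,\frac{\prod_{\ell\le q}U_\ell}{V^q}.$$ **The set $\mathcal{M}_{inv}$.** $\mathcal{M}_{inv}$ is the set of distributions $\mu$ of arrays $(s_i^\ell)_{i,\ell\ge1}$ generated by measurable functions $\sigma:[0,1]^4\to\{-1,1\}$ that satisfy the cavity equations for all choices of $n,m,q,r$ and $C_1,\ldots,C_q$. Such a $\sigma$ is called the function corresponding to $\mu$. *)

(* Defs.v *)
From HB Require Import structures.
From mathcomp Require Import all_boot all_order all_algebra.
From mathcomp Require Import all_classical all_reals all_analysis.

Set Implicit Arguments.
Unset Strict Implicit.
Unset Printing Implicit Defensive.

Import Order.TTheory GRing.Theory Num.Theory.
Import numFieldNormedType.Exports.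

Local Open Scope classical_set_scope.
Local Open Scope ring_scope.

(* Mutual independence of set systems: the product rule over every finite
   subfamily, a finite subfamily being an injective 'I_n -> I. *)
Definition mutually_independent d (T : measurableType d) (R : realType)
    (P : probability T R) (I : Type) (E : I -> set (set T)) : Prop :=
  forall (n : nat) (k : 'I_n -> I), injective k ->
  forall A : 'I_n -> set T, (forall j, E (k j) (A j)) ->
  P (\bigcap_(j in [set: 'I_n]) A j) = (\prod_(j < n) fine (P (A j)))%:E.

Definition sigma_of d d' (T : measurableType d) (T' : measurableType d')
    (X : T -> T') : set (set T) :=
  preimage_set_system [set: T] X measurable.

(* A uniform variable takes its values in [0, 1] everywhere, not just almost
   surely, so that it can be substituted into a function on [0, 1]^4. *)
Definition uniform01 d (T : measurableType d) (R : realType)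
    (P : probability T R) (X : {RV P >-> R}) : Prop :=
  (forall t, 0 <= X t <= 1) /\
  (forall A : set R, measurable A ->
    distribution P X A = uniform_prob (@ltr01 R) A).

(* A random sign is the bit b standing for (-1) ^+ b. *)
Definition fair_bit d (T : measurableType d) (R : realType)
    (P : probability T R) (X : {RV P >-> bool}) : Prop :=
  forall b, P (X @^-1` [set b]) = (2^-1)%:E.

Definition poisson_variable d (T : measurableType d) (R : realType)
    (P : probability T R) (rate : R) (X : {RV P >-> nat}) : Prop :=
  forall k : nat, P (X @^-1` [set k]) = (poisson_pmf rate k)%:E.

(* The randomness lives on a product of two probability spaces: the first
   carries the variables below, the second those of [thermal].  The
   expectation E' in u, x and x-hat only is thus integration over the second
   factor, and what remains is a function on the first factor.
   Indices start from 0 and multi-indices are sequences of naturals. *)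
Record disorder d (T : measurableType d) (R : realType)
    (P : probability T R) (p : nat) := Disorder {
  dis_w : {RV P >-> R};
  dis_v : seq nat -> {RV P >-> R};
  dis_vhat : seq nat -> {RV P >-> R};
  (* signs of theta_{k,i} *)
  dis_J : nat -> nat -> 'I_p -> {RV P >-> bool};
  (* signs of theta-hat_k *)
  dis_Jhat : nat -> 'I_p -> {RV P >-> bool};
  dis_pi : nat -> {RV P >-> nat}
}.

Inductive disorder_index (p : nat) : Type :=
  | Index_w
  | Index_v of seq nat
  | Index_vhat of seq nat
  | Index_J of nat & nat & 'I_p
  | Index_Jhat of nat & 'I_p
  | Index_pi of nat.

Definition disorder_sigma d (T : measurableType d) (R : realType)
    (P : probability T R) (p : nat) (D : disorder P p)
    (i : disorder_index p) : set (set T) :=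
  match i with
  | Index_w => sigma_of (dis_w D)
  | Index_v s => sigma_of (dis_v D s)
  | Index_vhat s => sigma_of (dis_vhat D s)
  | Index_J k i j => sigma_of (dis_J D k i j)
  | Index_Jhat k j => sigma_of (dis_Jhat D k j)
  | Index_pi i => sigma_of (dis_pi D i)
  end.

Record disorder_law d (T : measurableType d) (R : realType)
    (P : probability T R) (p : nat) (alpha : R) (D : disorder P p) : Prop :=
  DisorderLaw {
  law_w : uniform01 (dis_w D);
  law_v : forall s, uniform01 (dis_v D s);
  law_vhat : forall s, uniform01 (dis_vhat D s);
  law_J : forall k i j, fair_bit (dis_J D k i j);
  law_Jhat : forall k j, fair_bit (dis_Jhat D k j);
  law_pi : forall i, poisson_variable (alpha * p%:R) (dis_pi D i);
  disorder_indep : mutually_independent P (disorder_sigma D)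
}.

(* th_us and th_xs are the variables u_l and x_{i,l} of the array (s_i^l);
   th_u, th_x and th_xhat are those of the cavity equations. *)
Record thermal d (T : measurableType d) (R : realType)
    (P : probability T R) := Thermal {
  th_u : {RV P >-> R};
  th_x : seq nat -> {RV P >-> R};
  th_xhat : seq nat -> {RV P >-> R};
  th_us : nat -> {RV P >-> R};
  th_xs : nat -> nat -> {RV P >-> R}
}.

Inductive thermal_index : Type :=
  | Index_u
  | Index_x of seq nat
  | Index_xhat of seq nat
  | Index_us of nat
  | Index_xs of nat & nat.

Definition thermal_var d (T : measurableType d) (R : realType)
    (P : probability T R) (X : thermal P) (i : thermal_index) : {RV P >-> R} :=
  match i with
  | Index_u => th_u X
  | Index_x s => th_x X s
  | Index_xhat s => th_xhat X s
  | Index_us l => th_us X l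
  | Index_xs i l => th_xs X i l
  end.

Definition thermal_law d (T : measurableType d) (R : realType)
    (P : probability T R) (X : thermal P) : Prop :=
  (forall i, uniform01 (thermal_var X i)) /\
  mutually_independent P (fun i => sigma_of (thermal_var X i)).

Definition cube4 (R : realType) : set (R * R * R * R) :=
  [set y | [/\ 0 <= y.1.1.1 <= 1, 0 <= y.1.1.2 <= 1,
               0 <= y.1.2 <= 1 & 0 <= y.2 <= 1]].

(* sigma restricts to a measurable function [0, 1]^4 -> {-1, 1}; its values
   off the cube are never used. *)
Definition sign_function (R : realType) (sigma : R * R * R * R -> R) : Prop :=
  measurable_fun (@cube4 R) sigma /\
  (forall y, cube4 y -> sigma y = -1 \/ sigma y = 1).

Definition array_cylinders (R : realType) : set (set (nat -> nat -> R)) :=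
  [set B | exists (i l : nat) (A : set R),
             measurable A /\ B = [set s | A (s i l)]].

Definition array_space (R : realType) := g_sigma_algebraType (@array_cylinders R).

Definition theta (R : realType) (p : nat) (beta : R) (J : 'I_p -> bool)
    (s : 'I_p -> R) : R :=
  ln (1 + (expR (- beta) - 1) * \prod_(i < p) ((1 + (-1) ^+ J i * s i) / 2)).

Definition sign_average (R : realType) (m : nat) (F : ('I_m -> R) -> R) : R :=
  (\sum_(b : {ffun 'I_m -> bool}) F (fun i => (-1) ^+ b i)) / 2 ^+ m.

Section Cavity.
Context d d' (T : measurableType d) (T' : measurableType d') (R : realType).
Variables (P : probability T R) (P' : probability T' R).
Variables (p : nat) (beta : R) (D : disorder P p) (X : thermal P').
Variable sigma : R * R * R * R -> R.

(* i is the lower index and l the upper one. *)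
Definition generated_array (t : T * T') : array_space R :=
  fun i l => sigma (dis_w D t.1, th_us X l t.2,
                    dis_v D [:: i] t.1, th_xs X i l t.2).

Definition generates (mu : probability (array_space R) R) : Prop :=
  forall B : set (array_space R), measurable B ->
    mu B = (P \x P')%E (generated_array @^-1` B).

Definition spin (I : seq nat) (t : T) (t' : T') : R :=
  sigma (dis_w D t, th_u X t', dis_v D I t, th_x X I t').

Definition spin_hat (I : seq nat) (t : T) (t' : T') : R :=
  sigma (dis_w D t, th_u X t', dis_vhat D I t, th_xhat X I t').

Definition cavity_field (i : nat) (eps : R) (t : T) (t' : T') : R :=
  \sum_(k < dis_pi D i t)
    theta beta (fun j => dis_J D k i j t)
      (fun j : 'I_p => if (j < p.-1)%N then spin [:: val j; i; val k] t t'
                       else eps).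

Definition theta_hat_sum (r : nat) (t : T) (t' : T') : R :=
  \sum_(k < r)
    theta beta (fun j => dis_Jhat D k j t)
      (fun j : 'I_p => spin_hat [:: val j; val k] t t').

Definition E' (F : T' -> R) : R := Rintegral P' [set: T'] F.

(* The average runs over (eps_i)_{i < m}, of which only i < n occur. *)
Definition cavity_U (n m r : nat) (C : {set 'I_m}) (t : T) : R :=
  E' (fun t' =>
    sign_average (fun eps : 'I_m -> R =>
      (\prod_(i in C | (i < n)%N) eps i) *
      expR (\sum_(i < m | (i < n)%N) cavity_field i (eps i) t t')) *
    (\prod_(i in C | (n <= i)%N) spin [:: val i] t t') *
    expR (theta_hat_sum r t t')).

Definition cavity_V (n m r : nat) (t : T) : R :=
  E' (fun t' =>
    sign_average (fun eps : 'I_m -> R =>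
      expR (\sum_(i < m | (i < n)%N) cavity_field i (eps i) t t')) *
    expR (theta_hat_sum r t t')).

Definition cavity_equation (n m q r : nat) (C : 'I_q -> {set 'I_m}) : Prop :=
  Rintegral P [set: T] (fun t =>
    \prod_(l < q) E' (fun t' => \prod_(i in C l) spin [:: val i] t t')) =
  Rintegral P [set: T] (fun t =>
    (\prod_(l < q) cavity_U n r (C l) t) / cavity_V n m r t ^+ q).

Definition corresponding (mu : probability (array_space R) R) : Prop :=
  [/\ sign_function sigma, generates mu &
      forall n m q r : nat, (1 <= n)%N -> (n <= m)%N -> (1 <= q)%N ->
      forall C : 'I_q -> {set 'I_m}, cavity_equation n r C].

End Cavity.

Definition M_inv d d' (T : measurableType d) (T' : measurableType d')
    (R : realType) (P : probability T R) (P' : probability T' R)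
    (p : nat) (beta : R) (D : disorder P p) (X : thermal P') :
    set (probability (array_space R) R) :=
  [set mu | exists sigma : R * R * R * R -> R,
              corresponding beta D X sigma mu].

Definition sigma_bar (R : realType) (sigma : R * R * R * R -> R)
    (w u v : R) : R :=
  Rintegral lebesgue_measure `[0, 1] (fun x => sigma (w, u, v, x)).

(* Main.v *)
Require Import Defs.
From HB Require Import structures.
From mathcomp Require Import all_boot all_order all_algebra.
From mathcomp Require Import all_classical all_reals all_analysis.
From mathcomp Require Import measurable_realfun.
From mathcomp Require Import ring lra.

Set Implicit Arguments.
Unset Strict Implicit.
Unset Printing Implicit Defensive.

Import Order.TTheory GRing.Theory Num.Theory.
Import numFieldNormedType.Exports.

Local Open Scope classical_set_scope.
Local Open Scope ring_scope.

(* Write <f> for the average of f over two replicas drawn independently from the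
   random law nu of finitely many spins.  Suppose that |f| <= f' and that f
   changes sign when the replicas are exchanged at the sites of a set A.  The
   cavity equations turn <f>/<f'> into a ratio of the same kind over the
   neighbors of the sites, antisymmetric under the exchange at the neighbors of
   A.  The two-replica factor of one interaction lies in [e^(-2 beta), 1], so
   with weight e^(-2 beta) an interaction can be dropped altogether; this gives
   E (<f>/<f'>)^2 <= #|A| rho^k for all k, where
   rho = (1 - e^(-2 beta)) (p - 1) p alpha < 1 bounds the mean number of retained
   neighbors of a site.  Taking f = (s^1_0 - s^2_0) (s^1_1 - s^2_1), the
   covariance of two spins vanishes almost surely.  In other words the kernel
   int a(w, u, v) a(w, u, v') du of a = sigma_bar - E_u sigma_bar is null, which
   forces a = 0 almost everywhere. *)

(** * Uniform limits of polynomials in spin moments *)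

Section RegularFunctions.
Context (R : realType).

(** Squares are estimated for the sake of convexity: splitting an interaction makes the ratio a
    convex combination of two ratios. Their weights have to be constants for the two expectations to
    be bounded separately, since the ratios and the normalizations depend on the same random law.
    This forces the dropped part of an interaction to depend on [nu], and hence all functions to
    have coefficients depending on [nu]. The cavity equations, on the other hand, equate only
    expectations of products of moments, so every ratio has to be a uniform limit of polynomials in
    moments; this is why each denominator is kept above a positive constant. The antisymmetry
    survives a step because exchanging two replicas at a site and at all its neighbors permutes the
    two factors of each of its interactions. The neighbors of a retained interaction thus join the
    exchanged sites, and those of a dropped one do not. The neighbors have labels of their own,
    whose variables are independent of the numbers and signs of the interactions: given these, the
    previous estimate applies to the law of the neighbors. *)

Definition conf (m : nat) := {ffun 'I_m -> bool}.

Definition simplex (m : nat) (nu : conf m -> R) : Prop :=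
  (forall s, 0 <= nu s) /\ \sum_s nu s = 1.

Definition chi (m : nat) (C : {set 'I_m}) (s : conf m) : R :=
  \prod_(i in C) (-1) ^+ s i.

Definition moment (m : nat) (nu : conf m -> R) (C : {set 'I_m}) : R :=
  \sum_s chi C s * nu s.

(** A monomial is a coefficient with a list of sets of sites. Its product of moments has the shape
    of one side of a cavity equation, [q] being the length of the list. *)
Definition moment_poly (m : nat) (l : seq (R * seq {set 'I_m}))
    (nu : conf m -> R) : R :=
  \sum_(x <- l) x.1 * \prod_(C <- x.2) moment nu C.

(* The functions of [nu] to which the cavity equations, which are identities
   between mixed moments, extend.  The numerators and denominators below have
   coefficients in this class, hence may depend on [nu] themselves. *)
Definition regular (m : nat) (Phi : (conf m -> R) -> R) : Prop :=
  forall e, 0 < e -> exists l, forall nu, simplex nu ->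
    `|Phi nu - moment_poly l nu| <= e.

Section Fixed.
Variable m : nat.
Implicit Types (Phi Psi : (conf m -> R) -> R) (nu : conf m -> R).

Lemma normr_chi (C : {set 'I_m}) (s : conf m) : `|chi C s| = 1 :> R.
Proof.
by rewrite normr_prod big1// => i _; rewrite normrX normrN1 expr1n.
Qed.

Lemma normr_moment nu (C : {set 'I_m}) : simplex nu -> `|moment nu C| <= 1.
Proof.
move=> [nu0 <-]; rewrite (le_trans (ler_norm_sum _ _ _))//.
by apply: ler_sum => s _; rewrite normrM normr_chi mul1r ger0_norm.
Qed.

Lemma moment_poly_cat l l' nu :
  moment_poly (l ++ l') nu = moment_poly l nu + moment_poly l' nu.
Proof. by rewrite /moment_poly big_cat. Qed.

Lemma moment_poly_mul l l' nu :
  moment_poly [seq (x.1 * y.1, x.2 ++ y.2) | x <- l, y <- l'] nu =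
  moment_poly l nu * moment_poly l' nu.
Proof.
rewrite /moment_poly big_allpairs_dep big_distrl/=; apply: eq_bigr => x _.
rewrite big_distrr/=; apply: eq_bigr => y _.
by rewrite big_cat/= mulrACA.
Qed.

Lemma moment_poly_bounded l :
  exists2 M, 0 <= M & forall nu, simplex nu -> `|moment_poly l nu| <= M.
Proof.
exists (\sum_(x <- l) `|x.1|); first by apply: sumr_ge0 => *.
move=> nu nuS; rewrite (le_trans (ler_norm_sum _ _ _))//.
apply: ler_sum => x _; rewrite normrM -[leRHS]mulr1 ler_wpM2l//.
by rewrite normr_prod; apply: prodr_ile1 => C _; rewrite normr_ge0 normr_moment.
Qed.

Lemma regular_ext Phi Psi : regular Psi ->
  (forall nu, simplex nu -> Phi nu = Psi nu) -> regular Phi.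
Proof.
move=> rPsi eqP e e0; have [l lP] := rPsi e e0.
by exists l => nu nuS; rewrite eqP//; exact: lP.
Qed.

Lemma regular_lim Phi :
  (forall e, 0 < e -> exists2 Psi, regular Psi &
     forall nu, simplex nu -> `|Phi nu - Psi nu| <= e) -> regular Phi.
Proof.
move=> H e e0; have e20 : 0 < e / 2 by rewrite divr_gt0.
have [Psi rPsi PP] := H _ e20; have [l lP] := rPsi _ e20.
exists l => nu nuS; rewrite [e]splitr.
by rewrite (le_trans (ler_distD (Psi nu) _ _))// lerD ?PP ?lP.
Qed.

Lemma regular_moment_poly (l : seq (R * seq {set 'I_m})) :
  regular (moment_poly l).
Proof.
by move=> e e0; exists l => nu _; rewrite subrr normr0 ltW.
Qed.

Lemma regular_bounded Phi : regular Phi ->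
  exists2 M, 0 < M & forall nu, simplex nu -> `|Phi nu| <= M.
Proof.
move=> /(_ 1 ltr01)[l lP]; have [M M0 MP] := moment_poly_bounded l.
exists (1 + M); first by rewrite ltr_pwDl.
move=> nu nuS; rewrite -[Phi nu](subrK (moment_poly l nu)).
by rewrite (le_trans (ler_normD _ _))// lerD ?lP ?MP.
Qed.

Lemma regular_cst (c : R) : regular (fun _ : conf m -> R => c).
Proof.
move=> e e0; exists [:: (c, [::])] => nu _.
by rewrite /moment_poly big_seq1/= big_nil mulr1 subrr normr0 ltW.
Qed.

Lemma regularD Phi Psi :
  regular Phi -> regular Psi -> regular (fun nu => Phi nu + Psi nu).
Proof.
move=> rP rQ e e0; have e20 : 0 < e / 2 by rewrite divr_gt0.
have [l lP] := rP _ e20; have [l' lP'] := rQ _ e20.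
exists (l ++ l') => nu nuS; rewrite moment_poly_cat opprD addrACA [e]splitr.
by rewrite (le_trans (ler_normD _ _))// lerD ?lP ?lP'.
Qed.

Lemma regularM Phi Psi :
  regular Phi -> regular Psi -> regular (fun nu => Phi nu * Psi nu).
Proof.
move=> rP rQ e e0; have [M M0 MP] := regular_bounded rQ.
have [|l lP] := rP (e / 2 / M); first by rewrite !divr_gt0.
(* The error allowed for [l'] is fixed only now, since it depends on a bound [N] for the polynomial
   [l] just chosen. *)
have [N N0 NP] := regular_bounded (regular_moment_poly l).
have [|l' lP'] := rQ (e / 2 / N); first by rewrite !divr_gt0.
exists [seq (x.1 * y.1, x.2 ++ y.2) | x <- l, y <- l'] => nu nuS.
rewrite moment_poly_mul.
have -> : Phi nu * Psi nu - moment_poly l nu * moment_poly l' nu =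
  (Phi nu - moment_poly l nu) * Psi nu
  + moment_poly l nu * (Psi nu - moment_poly l' nu) by ring.
rewrite (le_trans (ler_normD _ _))// [leRHS]splitr !normrM lerD//.
  rewrite -[leRHS](@divfK _ M) ?gt_eqF//.
  by apply: ler_pM => //; [exact: lP|exact: MP].
rewrite -[leRHS](@divfK _ N) ?gt_eqF// mulrC.
by apply: ler_pM => //; [exact: lP'|exact: NP].
Qed.

Lemma regularN Phi : regular Phi -> regular (fun nu => - Phi nu).
Proof.
move=> rP; apply: regular_ext (regularM (regular_cst (-1)) rP) _ => nu _.
by rewrite mulN1r.
Qed.

Lemma regularB Phi Psi :
  regular Phi -> regular Psi -> regular (fun nu => Phi nu - Psi nu).
Proof. by move=> rP rQ; apply: regularD => //; exact: regularN. Qed.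

Lemma regular_sum (I : Type) (r : seq I) (Q : pred I)
    (Phi : I -> (conf m -> R) -> R) :
  (forall i, regular (Phi i)) ->
  regular (fun nu => \sum_(i <- r | Q i) Phi i nu).
Proof.
move=> rP; elim: r => [|i r IH].
  by apply: regular_ext (regular_cst 0) _ => nu _; rewrite big_nil.
case Qi: (Q i); last first.
  by apply: regular_ext IH _ => nu _; rewrite big_cons Qi.
by apply: regular_ext (regularD (rP i) IH) _ => nu _; rewrite big_cons Qi.
Qed.

Lemma regular_prod (I : Type) (r : seq I) (Q : pred I)
    (Phi : I -> (conf m -> R) -> R) :
  (forall i, regular (Phi i)) ->
  regular (fun nu => \prod_(i <- r | Q i) Phi i nu).
Proof.
move=> rP; elim: r => [|i r IH].
  by apply: regular_ext (regular_cst 1) _ => nu _; rewrite big_nil.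
case Qi: (Q i); last first.
  by apply: regular_ext IH _ => nu _; rewrite big_cons Qi.
by apply: regular_ext (regularM (rP i) IH) _ => nu _; rewrite big_cons Qi.
Qed.

Lemma regularX Phi n : regular Phi -> regular (fun nu => Phi nu ^+ n).
Proof.
move=> rP; elim: n => [|n IH]; first exact: regular_cst.
by apply: regular_ext (regularM rP IH) _ => nu _; rewrite exprS.
Qed.

Lemma regular_moment (C : {set 'I_m}) : regular (fun nu => moment nu C).
Proof.
apply: regular_ext (regular_moment_poly [:: (1, [:: C])]) _ => nu _.
by rewrite /moment_poly big_seq1/= big_seq1 mul1r.
Qed.

(** Orthogonality of the Walsh functions: the sum over [C] expands a product over the sites of
    factors [1 + s_i s'_i], each equal to 2 or 0. *)
Lemma sum_chi (s s' : conf m) :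
  \sum_(C : {set 'I_m}) chi C s * chi C s' = (2 ^ m)%:R * (s == s')%:R :> R.
Proof.
have -> : \sum_(C : {set 'I_m}) chi C s * chi C s' =
  \prod_i ((-1) ^+ s i * (-1) ^+ s' i + 1) :> R.
  rewrite bigA_distr/=; apply: eq_bigr => C _.
  by rewrite /chi -big_split/= [LHS]big_mkcond.
have [<-|neq] := eqVneq s s'.
  under eq_bigr do rewrite -expr2 sqrr_sign.
  by rewrite prodr_const card_ord mulr1 natrX.
have [i si] : exists i, s i != s' i.
  apply/existsP; apply: contraR neq => /existsPn H.
  by apply/eqP/ffunP => i; apply/eqP; have := H i; rewrite negbK.
rewrite mulr0 (bigD1 i)//=.
by case: (s i) (s' i) si => -[]//= _; rewrite !(expr0, expr1) ?(mulr1, mul1r) addNr mul0r.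
Qed.

(** Inversion of the Walsh transform; through it the probabilities [nu s], and all polynomials in
    them, become regular. *)
Lemma moment_inv nu (s : conf m) :
  nu s = \sum_(C : {set 'I_m}) (2 ^ m)%:R^-1 * chi C s * moment nu C.
Proof.
have m0 : (2 ^ m)%:R != 0 :> R by rewrite pnatr_eq0 expn_eq0.
under eq_bigr do rewrite /moment -mulrA !big_distrr/=.
rewrite exchange_big/=.
under eq_bigr => t _.
  under eq_bigr do rewrite !mulrA -[_ * chi _ s * _]mulrA.
  rewrite -mulr_suml -mulr_sumr sum_chi mulrA mulVf// mul1r; over.
rewrite (bigD1 s)//= eqxx mul1r big1 ?addr0// => t ts.
by rewrite eq_sym (negbTE ts) mul0r.
Qed.

Lemma regular_coord (s : conf m) : regular (fun nu => nu s).
Proof.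
apply: regular_ext; last by move=> nu _; rewrite moment_inv; reflexivity.
apply: regular_sum => C; apply: regularM; first exact: regular_cst.
exact: regular_moment.
Qed.

(** With [M] an upper bound of [Phi], the inverse is [M^-1] times the geometric series in
    [1 - Phi / M]. This quantity stays in [[0, 1 - c / M]], so the convergence is uniform on the
    simplex. *)
Lemma regularV Phi (c : R) : regular Phi -> 0 < c ->
  (forall nu, simplex nu -> c <= Phi nu) -> regular (fun nu => (Phi nu)^-1).
Proof.
move=> rP c0 cP; have [M0 M00 M0P] := regular_bounded rP.
pose M := Num.max c M0.
have M_gt0 : 0 < M by rewrite lt_max c0.
have MP nu : simplex nu -> Phi nu <= M.
  by move=> nuS; rewrite le_max (le_trans (ler_norm _) (M0P _ nuS)) orbT.
pose q := 1 - c / M.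
have q0 : 0 <= q by rewrite subr_ge0 ler_pdivrMr// mul1r le_max lexx.
have q1 : `|q| < 1 by rewrite ger0_norm// ltrBlDr ltrDl divr_gt0.
pose r nu := 1 - Phi nu / M.
pose S N nu := M^-1 * \sum_(k < N) r nu ^+ k.
have rS N : regular (S N).
  apply: regularM; first exact: regular_cst.
  apply: regular_sum => k; apply: regularX.
  apply: regularB; first exact: regular_cst.
  by apply: regularM => //; exact: regular_cst.
have r0 nu : simplex nu -> 0 <= r nu <= q.
  move=> nuS; apply/andP; split.
    by rewrite subr_ge0 ler_pdivrMr// mul1r MP.
  by rewrite lerD2l lerN2 ler_wpM2r ?cP// invr_ge0 ltW.
apply: regular_lim => e e0.
have /cvgrPdist_le/(_ (e * c))[|N _ /(_ N (leqnn _))/=] := cvg_expr q1.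
  exact: mulr_gt0.
rewrite sub0r normrN ger0_norm ?exprn_ge0// => qN.
exists (S N) => // nu nuS.
have P0 : 0 < Phi nu by rewrite (lt_le_trans c0)// cP.
have -> : (Phi nu)^-1 - S N nu = r nu ^+ N / Phi nu.
  have := subrX1 (r nu) N; rewrite {2}/r addrAC subrr add0r mulNr.
  move=> /(congr1 -%R); rewrite opprB opprK => rN.
  have -> : r nu ^+ N = 1 - Phi nu / M * \sum_(i < N) r nu ^+ i.
    by rewrite -rN; ring.
  by rewrite /S; field; rewrite !gt_eqF.
have /andP[rn0 rq] := r0 _ nuS.
rewrite ger0_norm; last by rewrite divr_ge0 ?exprn_ge0// (ltW P0).
rewrite ler_pdivrMr// (le_trans (lerXn2r N _ _ rq)) ?nnegrE//.
by rewrite (le_trans qN)// ler_pM2l// cP.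
Qed.

End Fixed.

(** [G] maps simplex to simplex, so composition does not increase the error of a polynomial
    approximation of [Phi]; the approximation becomes a polynomial in the regular functions
    [G nu s]. *)
Lemma regular_comp (m n : nat) (Phi : (conf m -> R) -> R)
    (G : (conf n -> R) -> conf m -> R) :
  regular Phi -> (forall s, regular (fun nu => G nu s)) ->
  (forall nu, simplex nu -> simplex (G nu)) -> regular (fun nu => Phi (G nu)).
Proof.
move=> rP rG GS; apply: regular_lim => e e0; have [l lP] := rP _ e0.
exists (fun nu => moment_poly l (G nu)); last by move=> nu nuS; exact/lP/GS.
apply: regular_sum => x; apply: regularM; first exact: regular_cst.
apply: regular_prod => C; apply: regular_sum => s.
by apply: regularM => //; exact: regular_cst.
Qed.

End RegularFunctions.

(** * Thinning of the interactions *)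

Section Thinning.
Context (R : realType) (M : nat).
Implicit Types (nu : conf M -> R) (A : {set 'I_M}) (s : conf M).

(** The first replica after the exchange at [A]; the second one is [swap A s2 s1]. *)
Definition swap A s1 s2 : conf M := [ffun i => if i \in A then s2 i else s1 i].

Definition two_replica (f : conf M -> conf M -> (conf M -> R) -> R) nu : R :=
  \sum_s1 \sum_s2 nu s1 * nu s2 * f s1 s2 nu.

(** The last field keeps the denominator away from 0 uniformly in [nu], which makes the ratio of the
    two averages regular. *)
Record swap_pair A (f f' : conf M -> conf M -> (conf M -> R) -> R) : Prop :=
  SwapPair {
  swap_pair_regular : forall s1 s2, regular (f s1 s2);
  swap_pair_regular' : forall s1 s2, regular (f' s1 s2);
  swap_pair_le : forall nu s1 s2, simplex nu -> `|f s1 s2 nu| <= f' s1 s2 nu;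
  swap_pair_anti : forall nu s1 s2, simplex nu ->
    f (swap A s1 s2) (swap A s2 s1) nu = - f s1 s2 nu;
  swap_pair_low : exists2 c, 0 < c &
    forall nu, simplex nu -> c <= two_replica f' nu }.

Lemma swapK A s1 s2 : swap A (swap A s1 s2) (swap A s2 s1) = s1.
Proof. by apply/ffunP => i; rewrite !ffunE; case: (i \in A). Qed.

Lemma regular_two_replica f : (forall s1 s2, regular (f s1 s2)) ->
  regular (two_replica f).
Proof.
move=> rf; apply: regular_sum => s1; apply: regular_sum => s2.
by do 2 apply: regularM => //; exact: regular_coord.
Qed.

Lemma two_replicaD f g nu :
  two_replica (fun s1 s2 nu => f s1 s2 nu + g s1 s2 nu) nu =
  two_replica f nu + two_replica g nu.
Proof.
rewrite -big_split; apply: eq_bigr => s1 _; rewrite -big_split.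
by apply: eq_bigr => s2 _; rewrite mulrDr.
Qed.

Lemma eq_two_replica f g nu : (forall s1 s2, f s1 s2 nu = g s1 s2 nu) ->
  two_replica f nu = two_replica g nu.
Proof.
by move=> fg; apply: eq_bigr => s1 _; apply: eq_bigr => s2 _; rewrite fg.
Qed.

Lemma two_replicaZ (a : (conf M -> R) -> R) f nu :
  two_replica (fun s1 s2 nu => a nu * f s1 s2 nu) nu = a nu * two_replica f nu.
Proof.
rewrite big_distrr/=; apply: eq_bigr => s1 _; rewrite big_distrr/=.
by apply: eq_bigr => s2 _; rewrite mulrCA.
Qed.

Lemma le_two_replica f g nu : simplex nu ->
  (forall s1 s2, f s1 s2 nu <= g s1 s2 nu) ->
  two_replica f nu <= two_replica g nu.
Proof.
move=> [nu0 _] fg; apply: ler_sum => s1 _; apply: ler_sum => s2 _.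
by rewrite ler_wpM2l// mulr_ge0.
Qed.

Lemma normr_two_replica f f' nu : simplex nu ->
  (forall s1 s2, `|f s1 s2 nu| <= f' s1 s2 nu) ->
  `|two_replica f nu| <= two_replica f' nu.
Proof.
move=> nuS H; rewrite ler_norml; apply/andP; split.
  rewrite lerNl -mulN1r -(two_replicaZ (fun=> -1)).
  apply: le_two_replica => // s1 s2; rewrite mulN1r.
  by rewrite (le_trans (ler_norm _))// normrN.
by apply: le_two_replica => // s1 s2; exact: le_trans (ler_norm _) (H _ _).
Qed.

(** [Ex] stands for the expectation over the random law, and [c0] below for the constant reached at
    the previous step of the iteration. *)
Variables (Ex : ((conf M -> R) -> R) -> R).
Hypothesis Ex_le : forall Phi Psi, regular Phi -> regular Psi ->
  (forall nu, simplex nu -> Phi nu <= Psi nu) -> Ex Phi <= Ex Psi.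
Hypothesis Ex_lin : forall (a b : R) Phi Psi, regular Phi -> regular Psi ->
  Ex (fun nu => a * Phi nu + b * Psi nu) = a * Ex Phi + b * Ex Psi.

Variables (c0 : R).
Hypothesis c0_ge0 : 0 <= c0.
Hypothesis Ex_swap : forall A f f', swap_pair A f f' ->
  Ex (fun nu => (two_replica f nu / two_replica f' nu) ^+ 2) <= c0 * #|A|%:R.

(** [h : H] will be the pair of configurations of the sites and [tau] their exchange; [e : E] an
    interaction, [B e] its two-replica factor, and [AE e] the neighbors that have to be exchanged on
    account of [e]. *)
Variables (H : finType) (tau : H -> H) (E : Type).
Hypothesis tauK : involutive tau.
Variables (AE : E -> {set 'I_M}) (B : E -> H -> conf M -> conf M -> R).
Variables (Atot : {set 'I_M}) (lo : R).
Hypothesis lo01 : 0 < lo < 1.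
Hypothesis BP : forall e h s1 s2, lo <= B e h s1 s2 <= 1.
Hypothesis AEP : forall e, AE e \subset Atot.
Hypothesis B_swap : forall e A h s1 s2, AE e \subset A -> A \subset Atot ->
  B e (tau h) (swap A s1 s2) (swap A s2 s1) = B e h s1 s2.

Definition fold (F : H -> conf M -> conf M -> (conf M -> R) -> R) s1 s2 nu : R :=
  \sum_h F h s1 s2 nu.

Definition weigh (es : seq E) (F : H -> conf M -> conf M -> (conf M -> R) -> R)
  h s1 s2 nu : R := F h s1 s2 nu * \prod_(e <- es) B e h s1 s2.

(** Antisymmetry is required for every [A'] between [A] and [Atot], because [A] grows as
    interactions are retained and the property has to pass to the larger set. *)
Record thin_pair A (F F' : H -> conf M -> conf M -> (conf M -> R) -> R) : Prop :=
  ThinPair {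
  thin_pair_sub : A \subset Atot;
  thin_pair_regular : forall h s1 s2, regular (F h s1 s2);
  thin_pair_regular' : forall h s1 s2, regular (F' h s1 s2);
  thin_pair_le : forall nu h s1 s2, simplex nu ->
    `|F h s1 s2 nu| <= F' h s1 s2 nu;
  thin_pair_anti : forall nu A' h s1 s2, simplex nu ->
    A \subset A' -> A' \subset Atot ->
    F (tau h) (swap A' s1 s2) (swap A' s2 s1) nu = - F h s1 s2 nu }.

Lemma prodB01 es h s1 s2 : 0 <= \prod_(e <- es) B e h s1 s2 <= 1.
Proof.
have /andP[l0 _] := lo01.
have B0 e : 0 <= B e h s1 s2.
  by have /andP[+ _] := BP e h s1 s2; apply: le_trans; rewrite ltW.
rewrite prodr_ge0//=; apply: prodr_ile1 => e _.
by rewrite B0; have /andP[_ ->] := BP e h s1 s2.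
Qed.

Lemma regular_fold F : (forall h s1 s2, regular (F h s1 s2)) ->
  forall s1 s2, regular (fold F s1 s2).
Proof. by move=> rF s1 s2; apply: regular_sum. Qed.

Lemma regular_weigh es F : (forall h s1 s2, regular (F h s1 s2)) ->
  forall h s1 s2, regular (weigh es F h s1 s2).
Proof. by move=> rF h s1 s2; apply: regularM => //; exact: regular_cst. Qed.

Lemma thin_pair_nil A F F' : thin_pair A F F' ->
  (exists2 c, 0 < c &
    forall nu, simplex nu -> c <= two_replica (fold F') nu) ->
  swap_pair A (fold F) (fold F').
Proof.
move=> [AT rF rF' FF' FA] low; split => //.
- exact: regular_fold.
- exact: regular_fold.
- move=> nu s1 s2 nuS; rewrite (le_trans (ler_norm_sum _ _ _))//.
  by apply: ler_sum => h _; exact: FF'.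
- move=> nu s1 s2 nuS; rewrite /fold (reindex_inj (inv_inj tauK)) -sumrN.
  by apply: eq_bigr => h _; rewrite FA.
Qed.

Lemma convex_sqr (a x y : R) : 0 <= a <= 1 ->
  (a * x + (1 - a) * y) ^+ 2 <= a * x ^+ 2 + (1 - a) * y ^+ 2.
Proof.
move=> /andP[a0 a1]; rewrite -subr_ge0.
have -> : a * x ^+ 2 + (1 - a) * y ^+ 2 - (a * x + (1 - a) * y) ^+ 2 =
  a * (1 - a) * (x - y) ^+ 2 by ring.
by rewrite mulr_ge0 ?sqr_ge0// mulr_ge0// subr_ge0.
Qed.

(* The factor of each interaction [e] splits as [c + (B e - c)], where [c] is
   chosen (as a function of [nu]) so that the normalizations of the two parts
   have the fixed proportions [lo] and [1 - lo].  The first part no longer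
   sees the sites of [e]. *)
Lemma thinning es A F F' : thin_pair A F F' ->
  (exists2 c, 0 < c &
    forall nu, simplex nu -> c <= two_replica (fold (weigh es F')) nu) ->
  Ex (fun nu => (two_replica (fold (weigh es F)) nu /
                 two_replica (fold (weigh es F')) nu) ^+ 2)
  <= c0 * (#|A|%:R + (1 - lo) * \sum_(e <- es) #|AE e|%:R).
Proof.
have /andP[lo0 lo1] := lo01.
elim: es A F F' => [|e es IH] A F F' FP [c c_gt0 cP].
  have w0 G : weigh [::] G = G.
    by rewrite /weigh; do 4 apply: funext => ?; rewrite big_nil mulr1.
  rewrite big_nil mulr0 addr0 !w0; apply: Ex_swap; apply: thin_pair_nil => //.
  by exists c => //; rewrite w0 in cP.
have [AT rF rF' FF' FA] := FP.
pose D nu := two_replica (fold (weigh (e :: es) F')) nu.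
pose D0 nu := two_replica (fold (weigh es F')) nu.
have F'0 nu h s1 s2 : simplex nu -> 0 <= F' h s1 s2 nu.
  by move=> nuS; exact: le_trans (normr_ge0 _) (FF' _ _ _ _ nuS).
have weighE G h s1 s2 nu :
    weigh (e :: es) G h s1 s2 nu = B e h s1 s2 * weigh es G h s1 s2 nu.
  by rewrite /weigh big_cons mulrCA.
have w0 nu h s1 s2 : simplex nu -> 0 <= weigh es F' h s1 s2 nu.
  move=> nuS; rewrite mulr_ge0 ?F'0//.
  by have /andP[] := prodB01 es h s1 s2.
have DD0 nu : simplex nu -> D nu <= D0 nu.
  move=> nuS; apply: le_two_replica => // s1 s2; apply: ler_sum => h _.
  rewrite weighE -[leRHS]mul1r ler_wpM2r ?w0//.
  by have /andP[] := BP e h s1 s2.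
have Dc nu : simplex nu -> 0 < D nu.
  by move=> nuS; exact: lt_le_trans c_gt0 (cP _ nuS).
have D0c nu : simplex nu -> 0 < D0 nu.
  by move=> nuS; exact: lt_le_trans (Dc _ nuS) (DD0 _ nuS).
pose k nu := lo * D nu / D0 nu.
have k_lo nu : simplex nu -> 0 <= k nu <= lo.
  move=> nuS; have D00 := D0c _ nuS; rewrite /k; apply/andP; split.
    by rewrite divr_ge0 ?mulr_ge0 ?(ltW lo0) ?(ltW (Dc _ nuS)) ?(ltW D00).
  by rewrite ler_pdivrMr// ler_pM2l// DD0.
have rD0 : regular D0.
  by apply/regular_two_replica/regular_fold/regular_weigh.
have rD : regular D.
  by apply/regular_two_replica/regular_fold/regular_weigh.
have rk : regular k.
  apply: regularM; first by apply: regularM => //; exact: regular_cst.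
  apply: (@regularV _ _ _ c) => // nu nuS.
  by rewrite (le_trans (cP _ nuS))// DD0.
(* Since [k nu <= lo <= B e], the factor [B e - k nu] is nonnegative, so that [K F'] still dominates
   [K F]. *)
pose K G h s1 s2 nu := G h s1 s2 nu * (B e h s1 s2 - k nu).
have rK G : (forall h s1 s2, regular (G h s1 s2)) ->
    forall h s1 s2, regular (K G h s1 s2).
  move=> rG h s1 s2; apply: regularM => //; apply: regularB => //.
  exact: regular_cst.
have KP : thin_pair (A :|: AE e) (K F) (K F').
  split.
  - by rewrite finset.subUset AT AEP.
  - exact: rK.
  - exact: rK.
  - move=> nu h s1 s2 nuS; rewrite normrM.
    have /andP[_ kl] := k_lo _ nuS; have /andP[lB _] := BP e h s1 s2.
    rewrite (ger0_norm (x := B _ _ _ _ - _)); last first.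
      by rewrite subr_ge0 (le_trans kl).
    by rewrite ler_wpM2r ?FF'// subr_ge0 (le_trans kl).
  - move=> nu A' h s1 s2 nuS; rewrite finset.subUset => /andP[AA' AeA'] A'T.
    by rewrite /K FA// B_swap// mulNr.
have splitE G nu : two_replica (fold (weigh (e :: es) G)) nu =
    k nu * two_replica (fold (weigh es G)) nu +
    two_replica (fold (weigh es (K G))) nu.
  rewrite -two_replicaZ -two_replicaD; apply: eq_two_replica => s1 s2.
  rewrite /fold big_distrr/= -big_split/=; apply: eq_bigr => h _.
  by rewrite weighE /weigh /K; ring.
have KD nu : simplex nu ->
    two_replica (fold (weigh es (K F'))) nu = (1 - lo) * D nu.
  move=> nuS; have := splitE F' nu; rewrite -/(D nu) -/(D0 nu) /k => DE.
  have -> : two_replica (fold (weigh es (K F'))) nu =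
    D nu - lo * D nu / D0 nu * D0 nu by rewrite [in X in X - _]DE addrC addKr.
  by rewrite divfK ?gt_eqF ?D0c// mulrBl mul1r.
have IH1 := IH _ _ _ FP.
have {}IH1 : Ex (fun nu => (two_replica (fold (weigh es F)) nu / D0 nu) ^+ 2)
    <= c0 * (#|A|%:R + (1 - lo) * \sum_(e <- es) #|AE e|%:R).
  by apply: IH1; exists c => // nu nuS; rewrite (le_trans (cP _ nuS))// DD0.
have r1 : regular (fun nu => (two_replica (fold (weigh es F)) nu / D0 nu) ^+ 2).
  apply/regularX/regularM.
    by apply/regular_two_replica/regular_fold/regular_weigh.
  apply: (@regularV _ _ _ c) => // nu nuS.
  by rewrite (le_trans (cP _ nuS))// DD0.
have rQ : regular (fun nu =>
    (two_replica (fold (weigh (e :: es) F)) nu / D nu) ^+ 2).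
  apply/regularX/regularM; last exact: (@regularV _ _ _ c).
  by apply/regular_two_replica/regular_fold/regular_weigh.
have sumE : (1 - lo) * \sum_(x <- e :: es) #|AE x|%:R =
    (1 - lo) * #|AE e|%:R + (1 - lo) * \sum_(x <- es) #|AE x|%:R.
  by rewrite big_cons mulrDr.
have dl0 : 0 < 1 - lo by rewrite subr_gt0.
have low2 : exists2 c, 0 < c & forall nu, simplex nu ->
    c <= two_replica (fold (weigh es (K F'))) nu.
  exists ((1 - lo) * c); first exact: mulr_gt0.
  by move=> nu nuS; rewrite KD// ler_pM2l// cP.
have IH2 := IH _ _ _ KP low2.
have [c2 c20 c2P] := low2.
have r2 : regular (fun nu => (two_replica (fold (weigh es (K F))) nu /
    two_replica (fold (weigh es (K F'))) nu) ^+ 2).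
  apply/regularX/regularM; last apply: (@regularV _ _ _ c2) => //.
    by apply/regular_two_replica/regular_fold/regular_weigh/rK.
  by apply/regular_two_replica/regular_fold/regular_weigh/rK.
have rlin (a b : R) Phi Psi : regular Phi -> regular Psi ->
    regular (fun nu : conf M -> R => a * Phi nu + b * Psi nu).
  by move=> ? ?; apply: regularD; apply: regularM => //; exact: regular_cst.
(* The ratio for [e :: es] is the combination, with the constant weights [lo] and [1 - lo], of the
   ratio without [e] and of the ratio of [K F] to [K F']. *)
apply: (@le_trans _ _ (Ex (fun nu =>
    lo * (two_replica (fold (weigh es F)) nu / D0 nu) ^+ 2 +
    (1 - lo) * (two_replica (fold (weigh es (K F))) nu /
      two_replica (fold (weigh es (K F'))) nu) ^+ 2))).
  apply: Ex_le => //; first exact: rlin.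
  move=> nu nuS.
  rewrite (le_trans _ (convex_sqr _ _ _))//; last by rewrite (ltW lo0) ltW.
  rewrite splitE KD// /k -/(D nu) le_eqVlt; apply/orP; left; apply/eqP.
  by congr (_ ^+ 2); field; rewrite !gt_eqF ?Dc ?D0c.
rewrite Ex_lin//.
apply: (@le_trans _ _ (
    lo * (c0 * (#|A|%:R + (1 - lo) * \sum_(e <- es) #|AE e|%:R)) +
    (1 - lo) * (c0 * (#|A|%:R + #|AE e|%:R
                      + (1 - lo) * \sum_(e <- es) #|AE e|%:R)))).
  rewrite lerD// ler_pM2l//; apply: le_trans IH2 _.
  rewrite ler_wpM2l// lerD2r -natrD ler_nat.
  by rewrite cardsU leq_subr.
by rewrite sumE le_eqVlt; apply/orP; left; apply/eqP; ring.
Qed.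

End Thinning.

(** * One cavity step: from the sites to their neighbors *)

Section CavityStep.
Context (R : realType) (m K p : nat).

(* Site [i] has interactions [k < kappa i], each with neighbors [j < p.-1]; the
   last index [j = p.-1] is a dummy that no interaction reads. *)
Definition neighbor := ('I_m * 'I_K * 'I_p)%type.
Local Notation N := #|{: neighbor}|.
Implicit Types (S : conf N) (a : bool) (e : conf m) (nu : conf N -> R).

Definition site (i : 'I_m) (k : 'I_K) (j : 'I_p) : 'I_N := enum_rank (i, k, j).

Definition coords (y : 'I_N) : neighbor := enum_val y.

Lemma siteK i k j : coords (site i k j) = (i, k, j).
Proof. exact: enum_rankK. Qed.

Variables (kappa : 'I_m -> nat) (w : 'I_m -> 'I_K -> bool -> conf N -> R).
Variable (lw : R).
Hypothesis lw01 : 0 < lw < 1.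
Hypothesis wP : forall i k a S, lw <= w i k a S <= 1.
Hypothesis w_local : forall i k a S S',
  (forall j : 'I_p, (j < p.-1)%N -> S (site i k j) = S' (site i k j)) ->
  w i k a S = w i k a S'.

Definition cavity_weight e S : R :=
  \prod_i \prod_(k < K | (k < kappa i)%N) w i k (e i) S.

Definition cavity_mass e nu : R := \sum_S nu S * cavity_weight e S.

Definition cavity_total nu : R := \sum_e cavity_mass e nu.

(** The right-hand side of the cavity equations as a map on laws, for fixed numbers of interactions
    and fixed signs: the neighbors have law [nu], and the new spins are weighted by the
    interactions. *)
Definition cavity_map nu e : R := cavity_mass e nu / cavity_total nu.

(** This bound does not depend on [nu], so that dividing by [cavity_total] preserves regularity. *)
Definition cavity_low : R := \prod_(i < m) \prod_(k < K | (k < kappa i)%N) lw.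

Lemma cavity_low_gt0 : 0 < cavity_low.
Proof. by have /andP[? _] := lw01; do 2 apply: prodr_gt0 => ? _. Qed.

Lemma cavity_weight_ge e S : cavity_low <= cavity_weight e S.
Proof.
have /andP[/ltW l0 _] := lw01.
apply: ler_prod => i _; rewrite prodr_ge0//=; apply: ler_prod => k _.
by rewrite l0; have /andP[] := wP i k (e i) S.
Qed.

Lemma cavity_mass_ge e nu : simplex nu -> cavity_low <= cavity_mass e nu.
Proof.
move=> [nu0 nu1]; rewrite -[leLHS]mul1r -nu1 big_distrl/=.
by apply: ler_sum => S _; rewrite ler_wpM2l// cavity_weight_ge.
Qed.

Lemma cavity_total_ge nu : simplex nu -> cavity_low <= cavity_total nu.
Proof.
move=> nuS; rewrite /cavity_total (bigD1 [ffun=> false])//=.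
rewrite (le_trans (cavity_mass_ge [ffun=> false] nuS))// lerDl sumr_ge0// => e _.
exact: le_trans (ltW cavity_low_gt0) (cavity_mass_ge _ nuS).
Qed.

Lemma cavity_total_gt0 nu : simplex nu -> 0 < cavity_total nu.
Proof. by move=> nuS; exact: lt_le_trans cavity_low_gt0 (cavity_total_ge nuS). Qed.

Lemma cavity_map_simplex nu : simplex nu -> simplex (cavity_map nu).
Proof.
move=> nuS; have V0 := cavity_total_gt0 nuS; split=> [e|].
  rewrite divr_ge0 ?(ltW V0)//.
  exact: le_trans (ltW cavity_low_gt0) (cavity_mass_ge _ nuS).
by rewrite -mulr_suml -/(cavity_total nu) divff ?gt_eqF.
Qed.

Lemma regular_cavity_mass e : regular (cavity_mass e).
Proof.
apply: regular_sum => S; apply: regularM; first exact: regular_coord.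
exact: regular_cst.
Qed.

Lemma regular_cavity_map e : regular (cavity_map^~ e).
Proof.
apply: regularM; first exact: regular_cavity_mass.
apply: (regularV _ cavity_low_gt0); last exact: cavity_total_ge.
by apply: regular_sum; exact: regular_cavity_mass.
Qed.

Section Swap.
Variable A : {set 'I_m}.

(** Empty when the site is outside [A]: only neighbors of sites of [A] are ever exchanged. *)
Definition neighborhood (x : 'I_m * 'I_K) : {set 'I_N} :=
  [set y : 'I_N | [&& x.1 \in A, (coords y).1 == x & ((coords y).2 < p.-1)%N]].

Definition neighborhoods : {set 'I_N} :=
  [set y : 'I_N | ((coords y).1.1 \in A) && ((coords y).2 < p.-1)%N].

Lemma neighborhood_sub x : neighborhood x \subset neighborhoods.
Proof.
apply/fintype.subsetP => y; rewrite !inE => /and3P[xA /eqP yx ->].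
by rewrite yx xA.
Qed.

Lemma card_neighborhood x : (#|neighborhood x| <= p.-1)%N.
Proof.
pose g (j : 'I_p.-1) : 'I_N := site x.1 x.2 (widen_ord (leq_pred p) j).
have sub : neighborhood x \subset [set g j | j in 'I_p.-1]%SET.
  apply/fintype.subsetP => y; rewrite inE => /and3P[_ /eqP yx yp].
  apply/imsetP; exists (Ordinal yp) => //.
  rewrite /g /site -yx -[LHS]enum_valK; congr enum_rank.
  rewrite [LHS]surjective_pairing; congr (_, _); last exact: val_inj.
  exact: surjective_pairing.
rewrite (leq_trans (subset_leq_card sub))//.
by rewrite (leq_trans (leq_imset_card _ _))// card_ord.
Qed.

Definition pair_swap (h : conf m * conf m) : conf m * conf m :=
  (swap A h.1 h.2, swap A h.2 h.1).

Lemma pair_swapK : involutive pair_swap.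
Proof. by case=> e1 e2; rewrite /pair_swap/= !swapK. Qed.

Definition pair_weight (x : 'I_m * 'I_K) (h : conf m * conf m) S1 S2 : R :=
  w x.1 x.2 (h.1 x.1) S1 * w x.1 x.2 (h.2 x.1) S2.

Lemma pair_weightP x h S1 S2 : lw ^+ 2 <= pair_weight x h S1 S2 <= 1.
Proof.
have /andP[/ltW l0 _] := lw01.
have /andP[a1 a2] := wP x.1 x.2 (h.1 x.1) S1.
have /andP[b1 b2] := wP x.1 x.2 (h.2 x.1) S2.
rewrite /pair_weight expr2 ler_pM//= mulr_ile1//; exact: le_trans l0 _.
Qed.

(** For a site of [A] the spin and all the neighbors are exchanged together, which permutes the two
    factors of the product. For a site outside [A] neither the spin nor any neighbor moves, since
    [A'] is contained in [neighborhoods]. *)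
Lemma pair_weight_swap x (A' : {set 'I_N}) h S1 S2 :
  neighborhood x \subset A' -> A' \subset neighborhoods ->
  pair_weight x (pair_swap h) (swap A' S1 S2) (swap A' S2 S1) =
  pair_weight x h S1 S2.
Proof.
move=> /fintype.subsetP xA' /fintype.subsetP A'T; rewrite /pair_weight/=.
have [xA|xA] := boolP (x.1 \in A).
  have inA' (j : 'I_p) : (j < p.-1)%N -> site x.1 x.2 j \in A'.
    move=> jp; apply: xA'; rewrite inE siteK/= xA jp -surjective_pairing.
    by rewrite eqxx.
  rewrite mulrC !ffunE xA; congr (_ * _); apply: w_local => j jp;
  by rewrite ffunE inA'.
have notA' (j : 'I_p) : site x.1 x.2 j \notin A'.
  by apply/negP => /A'T; rewrite inE siteK/= (negbTE xA).
rewrite !ffunE (negbTE xA); congr (_ * _); apply: w_local => j jp;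
by rewrite ffunE (negbTE (notA' _)).
Qed.

Definition inner : seq ('I_m * 'I_K) :=
  [seq x : 'I_m * 'I_K <- enum {: 'I_m * 'I_K} | (x.1 \in A) && (x.2 < kappa x.1)%N].

(* The interactions of the sites outside [A] are kept as a weight: they are
   invariant under the exchange and need no thinning. *)
Definition cavity_lift (f : conf m -> conf m -> (conf m -> R) -> R)
    (h : conf m * conf m) S1 S2 nu : R :=
  f h.1 h.2 (cavity_map nu) *
  \prod_(x : 'I_m * 'I_K | (x.1 \notin A) && (x.2 < kappa x.1)%N)
     pair_weight x h S1 S2.

Lemma pair_weight_all h S1 S2 :
  cavity_weight h.1 S1 * cavity_weight h.2 S2 =
  (\prod_(x : 'I_m * 'I_K | (x.1 \notin A) && (x.2 < kappa x.1)%N)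
     pair_weight x h S1 S2) * \prod_(x <- inner) pair_weight x h S1 S2.
Proof.
rewrite /cavity_weight -big_split/=.
under eq_bigr do rewrite -big_split/=.
rewrite pair_big_dep/= big_filter big_enum_cond/=.
rewrite (bigID (fun x : 'I_m * 'I_K => x.1 \notin A))/=; congr (_ * _);
by apply: eq_big => // x; rewrite ?negbK andbC.
Qed.

(** Clearing denominators: the square of [cavity_total] is common to [f] and [f'] and cancels from
    their ratio. *)
Lemma two_replica_lift f nu : simplex nu ->
  two_replica f (cavity_map nu) * cavity_total nu ^+ 2 =
  two_replica (fold (weigh pair_weight inner (cavity_lift f))) nu.
Proof.
move=> nuS; have V0 := cavity_total_gt0 nuS.
transitivity (\sum_(h : conf m * conf m)
    cavity_mass h.1 nu * cavity_mass h.2 nu * f h.1 h.2 (cavity_map nu)).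
  rewrite /two_replica pair_bigA big_distrl/=; apply: eq_bigr => h _.
  by rewrite /cavity_map; field; rewrite gt_eqF.
rewrite /two_replica /fold.
under [RHS]eq_bigr => S1 _ do (under eq_bigr => S2 _ do rewrite big_distrr/=).
under [RHS]eq_bigr => S1 _ do rewrite exchange_big/=.
rewrite [RHS]exchange_big/=; apply: eq_bigr => h _.
rewrite /cavity_mass big_distrl/= big_distrl/=; apply: eq_bigr => S1 _.
rewrite big_distrr/= big_distrl/=; apply: eq_bigr => S2 _.
by rewrite /weigh /cavity_lift -[X in _ = _ * X]mulrA -pair_weight_all; ring.
Qed.

(** The set of exchanged neighbors starts empty: without the interactions of [A], exchanging the
    sites alone already changes the sign, whatever neighbors of [A] are exchanged with them. *)
Lemma thin_pair_lift f f' : swap_pair A f f' ->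
  thin_pair pair_swap neighborhoods finset.set0 (cavity_lift f) (cavity_lift f').
Proof.
move=> [rf rf' ff' fA low].
have rG g : (forall e1 e2, regular (g e1 e2)) ->
    forall h S1 S2, regular (cavity_lift g h S1 S2).
  move=> rg h S1 S2; apply: regularM; last exact: regular_cst.
  apply: (regular_comp (rg _ _)) => [e|nu]; first exact: regular_cavity_map.
  exact: cavity_map_simplex.
split.
- exact: finset.sub0set.
- exact: rG.
- exact: rG.
- move=> nu h S1 S2 nuS; have /andP[/ltW l0 _] := lw01.
  rewrite /cavity_lift normrM [X in _ * X]ger0_norm; last first.
    apply: prodr_ge0 => x _; have /andP[+ _] := pair_weightP x h S1 S2.
    by apply: le_trans; rewrite exprn_ge0.
  rewrite ler_wpM2r ?ff'//; last exact: cavity_map_simplex.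
  apply: prodr_ge0 => x _; have /andP[+ _] := pair_weightP x h S1 S2.
  by apply: le_trans; rewrite exprn_ge0.
- move=> nu A' h S1 S2 nuS _ A'T; rewrite /cavity_lift fA; last first.
    exact: cavity_map_simplex.
  rewrite mulNr; congr (- (_ * _)); apply: eq_bigr => x /andP[xA _].
  apply: pair_weight_swap => //; apply/fintype.subsetP => y.
  by rewrite inE (negbTE xA).
Qed.

Lemma sum_neighborhood :
  \sum_(x <- inner) #|neighborhood x|%:R <=
  p.-1%:R * \sum_(i in A) (kappa i)%:R :> R.
Proof.
rewrite -natr_sum -natr_sum -natrM ler_nat.
rewrite big_filter big_enum_cond/= mulnC big_distrl/=.
rewrite -(pair_big_dep (mem A) (fun i (k : 'I_K) => k < kappa i)%N
  (fun i k => #|neighborhood (i, k)|))/=.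
apply: leq_sum => i _.
apply: (@leq_trans (\sum_(k < K | (k < kappa i)%N) p.-1)).
  by apply: leq_sum => k _; exact: card_neighborhood.
rewrite sum_nat_const leq_mul2r; apply/orP; right.
rewrite cardE -(size_map val) -[leqRHS](size_iota 0); apply: uniq_leq_size.
  by rewrite map_inj_uniq ?enum_uniq//; exact: val_inj.
by move=> _ /mapP[k + ->]; rewrite mem_enum mem_iota.
Qed.

Variables (Ex : ((conf N -> R) -> R) -> R).
Hypothesis Ex_le : forall Phi Psi, regular Phi -> regular Psi ->
  (forall nu, simplex nu -> Phi nu <= Psi nu) -> Ex Phi <= Ex Psi.
Hypothesis Ex_lin : forall (a b : R) Phi Psi, regular Phi -> regular Psi ->
  Ex (fun nu => a * Phi nu + b * Psi nu) = a * Ex Phi + b * Ex Psi.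
Variables (c0 : R).
Hypothesis c0_ge0 : 0 <= c0.
Hypothesis Ex_swap : forall A f f', swap_pair A f f' ->
  Ex (fun nu => (two_replica f nu / two_replica f' nu) ^+ 2) <= c0 * #|A|%:R.

(** Thinning with [lo = lw ^+ 2], one factor [lw] for each replica. Starting from the empty set,
    only the neighbors of retained interactions are counted. *)
Lemma cavity_step f f' : swap_pair A f f' ->
  Ex (fun nu => (two_replica f (cavity_map nu) /
                 two_replica f' (cavity_map nu)) ^+ 2)
  <= c0 * ((1 - lw ^+ 2) * (p.-1%:R * \sum_(i in A) (kappa i)%:R)).
Proof.
move=> ff'; have [rf rf' _ _ [c c_gt0 cP]] := ff'.
have FF' := thin_pair_lift ff'.
have lo01 : 0 < lw ^+ 2 < 1.
  have /andP[l0 l1] := lw01.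
  by rewrite exprn_gt0//= exprn_ilt1// ltW.
have low : exists2 c, 0 < c & forall nu, simplex nu ->
    c <= two_replica (fold (weigh pair_weight inner (cavity_lift f'))) nu.
  exists (c * cavity_low ^+ 2); first by rewrite mulr_gt0 ?exprn_gt0 ?cavity_low_gt0.
  move=> nu nuS; rewrite -two_replica_lift// ler_pM ?exprn_ge0 ?(ltW c_gt0)//.
  - exact: ltW cavity_low_gt0.
  - exact/cP/cavity_map_simplex.
  - by rewrite lerXn2r ?nnegrE ?cavity_total_ge// ltW ?cavity_total_gt0 ?cavity_low_gt0.
have := thinning Ex_le Ex_lin c0_ge0 Ex_swap pair_swapK lo01 pair_weightP
  neighborhood_sub pair_weight_swap FF' low.
rewrite cards0 add0r => thin.
apply: le_trans (le_trans thin _); last first.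
  rewrite ler_wpM2l// ler_wpM2l//; last exact: sum_neighborhood.
  by rewrite subr_ge0; have /andP[_ /ltW] := lo01.
have [c2 c20 c2P] := low.
apply: Ex_le.
- pose Q (mu : conf m -> R) := (two_replica f mu / two_replica f' mu) ^+ 2.
  have rQ : regular Q.
    apply/regularX/regularM; first exact: regular_two_replica.
    by apply: (regularV _ c_gt0) => //; exact: regular_two_replica.
  exact: (regular_comp rQ regular_cavity_map cavity_map_simplex).
- have [_ rF rF' _ _] := FF'.
  apply/regularX/regularM.
    by apply: regular_two_replica; apply: regular_fold; exact: regular_weigh.
  apply: (regularV _ c20) => //.
  by apply: regular_two_replica; apply: regular_fold; exact: regular_weigh.
- move=> nu nuS; rewrite -!two_replica_lift// le_eqVlt; apply/orP; left.
  apply/eqP; congr (_ ^+ 2); have V0 := cavity_total_gt0 nuS.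
  have D0 : 0 < two_replica f' (cavity_map nu).
    by rewrite (lt_le_trans c_gt0)// cP//; exact: cavity_map_simplex.
  by field; rewrite !gt_eqF.
Qed.

End Swap.
End CavityStep.

(** * Bounded measurable functions and joint laws *)

Section BoundedMeasurable.
Context d (T : measurableType d) (R : realType) (P : probability T R).
Implicit Types (f g : T -> R) (D : set T).

Definition bounded_measurable f : Prop :=
  measurable_fun [set: T] f /\ exists M, forall x, `|f x| <= M.

Lemma bm_integrable D f : measurable D -> bounded_measurable f ->
  P.-integrable D (EFin \o f).
Proof.
move=> mD [mf [M fM]]; apply: measurable_bounded_integrable => //.
- by rewrite (le_lt_trans (probability_le1 P mD))// ltry.
- exact: measurable_funTS.
- exists M; split; first exact: num_real.
  by move=> x Mx t _ /=; rewrite (le_trans (fM t))// ltW.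
Qed.

Lemma bm_cst (c : R) : bounded_measurable (fun=> c).
Proof. by split; [exact: measurable_cst|exists `|c|]. Qed.

Lemma bmD f g : bounded_measurable f -> bounded_measurable g ->
  bounded_measurable (fun x => f x + g x).
Proof.
move=> [mf [M fM]] [mg [N gN]]; split; first exact: measurable_funD.
by exists (M + N) => x; rewrite (le_trans (ler_normD _ _))// lerD.
Qed.

Lemma bmM f g : bounded_measurable f -> bounded_measurable g ->
  bounded_measurable (fun x => f x * g x).
Proof.
move=> [mf [M fM]] [mg [N gN]]; split; first exact: measurable_funM.
by exists (M * N) => x; rewrite normrM ler_pM.
Qed.

Lemma bmN f : bounded_measurable f -> bounded_measurable (fun x => - f x).
Proof.
move=> [mf [M fM]]; split; first exact: measurableT_comp.
by exists M => x; rewrite normrN.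
Qed.

Lemma bmB f g : bounded_measurable f -> bounded_measurable g ->
  bounded_measurable (fun x => f x - g x).
Proof. by move=> bf bg; apply: bmD => //; exact: bmN. Qed.

Lemma bm_sum (I : Type) (r : seq I) (Q : pred I) (F : I -> T -> R) :
  (forall i, bounded_measurable (F i)) ->
  bounded_measurable (fun x => \sum_(i <- r | Q i) F i x).
Proof.
move=> bF; elim: r => [|i r IH].
  by under eq_fun do rewrite big_nil; exact: bm_cst.
under eq_fun do rewrite big_cons.
by case: (Q i) => //; exact: bmD.
Qed.

Lemma bm_prod (I : Type) (r : seq I) (Q : pred I) (F : I -> T -> R) :
  (forall i, bounded_measurable (F i)) ->
  bounded_measurable (fun x => \prod_(i <- r | Q i) F i x).
Proof.
move=> bF; elim: r => [|i r IH].
  by under eq_fun do rewrite big_nil; exact: bm_cst.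
under eq_fun do rewrite big_cons.
by case: (Q i) => //; exact: bmM.
Qed.

Lemma bm_Rintegral_lin D (a b : R) f g : measurable D ->
  bounded_measurable f -> bounded_measurable g ->
  Rintegral P D (fun x => a * f x + b * g x) =
  a * Rintegral P D f + b * Rintegral P D g.
Proof.
move=> mD bf bg.
rewrite -!RintegralZl//; [|exact: bm_integrable..].
by rewrite RintegralD//; apply: bm_integrable => //; apply: bmM => //; exact: bm_cst.
Qed.

Lemma bm_le_Rintegral D f g : measurable D ->
  bounded_measurable f -> bounded_measurable g ->
  (forall x, D x -> f x <= g x) -> Rintegral P D f <= Rintegral P D g.
Proof. by move=> mD bf bg fg; apply: le_Rintegral => //; exact: bm_integrable. Qed.

Lemma bm_Rintegral_sum (I : Type) (r : seq I) (Q : pred I) (F : I -> T -> R) D :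
  measurable D -> (forall i, bounded_measurable (F i)) ->
  Rintegral P D (fun x => \sum_(i <- r | Q i) F i x) =
  \sum_(i <- r | Q i) Rintegral P D (F i).
Proof.
move=> mD bF; elim: r => [|i r IH].
  by under eq_Rintegral do rewrite big_nil; rewrite big_nil Rintegral_cst// mul0r.
under eq_Rintegral do rewrite big_cons.
rewrite big_cons; case: (Q i) => //.
rewrite -IH RintegralD//; apply: bm_integrable => //; exact: bm_sum.
Qed.

Lemma bm_RintegralZl D (a : R) f : measurable D -> bounded_measurable f ->
  Rintegral P D (fun x => a * f x) = a * Rintegral P D f.
Proof. by move=> mD bf; rewrite RintegralZl//; exact: bm_integrable. Qed.

Lemma probability_Rintegral_cst (a : R) : Rintegral P [set: T] (fun=> a) = a.
Proof.
rewrite Rintegral_cst// [X in fine X](_ : _ = 1%E) ?mulr1//.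
exact: probability_setT.
Qed.

Lemma bm_EFin_Rintegral D f : measurable D -> bounded_measurable f ->
  (Rintegral P D f)%:E = (\int[P]_(x in D) (f x)%:E)%E.
Proof.
move=> mD bf; rewrite /Rintegral fineK//.
exact: integrable_fin_num (bm_integrable mD bf).
Qed.

End BoundedMeasurable.

Lemma bm_comp d d' (T : measurableType d) (T' : measurableType d')
    (R : realType) (f : T' -> R) (g : T -> T') :
  bounded_measurable f -> measurable_fun [set: T] g ->
  bounded_measurable (f \o g).
Proof.
move=> [mf [M fM]] mg; split; first exact: measurableT_comp.
by exists M => x /=.
Qed.

Lemma bm_fubini d d' (T : measurableType d) (T' : measurableType d')
    (R : realType) (P' : probability T' R) (f : T * T' -> R) :
  bounded_measurable f ->
  bounded_measurable (fun x => Rintegral P' [set: T'] (fun y => f (x, y))).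
Proof.
move=> [mf [M fM]].
have bx x : bounded_measurable (fun y => f (x, y)).
  apply: (@bm_comp _ _ _ _ _ f (pair x)); last exact: measurable_pair1.
  by split => //; exists M.
split; last first.
  exists M => x; rewrite (le_trans (le_normr_Rintegral _ _))//.
    exact: bm_integrable.
  rewrite -[leRHS](@probability_Rintegral_cst _ _ _ P').
  apply: bm_le_Rintegral => //; last exact: bm_cst.
  have [mfx [N fN]] := bx x; split; first exact: measurableT_comp.
  by exists N => y; rewrite normr_id.
(* The shift makes the integrand nonnegative, as the measurability part of Tonelli's theorem
   requires. *)
pose g z := f z + M.
have g0 z : 0 <= g z.
  by rewrite -lerBlDr sub0r; have := fM z; rewrite ler_norml => /andP[].
have mg : measurable_fun [set: T * T'] (fun z => (g z)%:E).
  by apply/measurable_EFinP; apply: measurable_funD.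
have := @measurable_fun_fubini_tonelli_F _ _ _ _ _ P' _ mg.
move=> /(_ (fun z => _)) mF.
rewrite (_ : (fun x => _) = (fun x => fine (\int[P']_y (g (x, y))%:E) - M)); last first.
  apply: funext => x; rewrite -/(Rintegral P' setT (fun y => g (x, y))).
  rewrite RintegralD//; [|exact: bm_integrable|exact/bm_integrable/bm_cst].
  by rewrite probability_Rintegral_cst addrK.
apply: measurable_funB => //; apply: measurableT_comp => //.
by apply: mF => z; rewrite lee_fin.
Qed.

Lemma bm_Fubini d d' (T : measurableType d) (T' : measurableType d')
    (R : realType) (P : probability T R) (P' : probability T' R)
    (f : T * T' -> R) : bounded_measurable f ->
  Rintegral P [set: T] (fun x => Rintegral P' [set: T'] (fun y => f (x, y))) =
  Rintegral P' [set: T'] (fun y => Rintegral P [set: T] (fun x => f (x, y))).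
Proof.
move=> bf; have [mf [M fM]] := bf.
have bx x : bounded_measurable (fun y => f (x, y)).
  by apply: (@bm_comp _ _ _ _ _ f (pair x)) => //; exact: measurable_pair1.
have by' y : bounded_measurable (fun x => f (x, y)).
  by apply: (@bm_comp _ _ _ _ _ f (pair^~ y)) => //; exact: measurable_pair2.
have fi : (P \x P')%E.-integrable setT (EFin \o f).
  exact: (@bm_integrable _ _ _ (P \x P')%E).
have := Fubini fi; rewrite /= => FE.
rewrite /Rintegral; congr fine.
under eq_integral do rewrite bm_EFin_Rintegral//.
under [RHS]eq_integral do rewrite bm_EFin_Rintegral//.
exact: FE.
Qed.

(** * Equality in law tested on a generating pi-system *)

Section Law.
Context d1 d2 d (T1 : measurableType d1) (T2 : measurableType d2)
  (U : measurableType d) (R : realType).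
Variables (P1 : probability T1 R) (P2 : probability T2 R).
Variables (X : T1 -> U) (Y : T2 -> U).
Hypothesis mX : measurable_fun [set: T1] X.
Hypothesis mY : measurable_fun [set: T2] Y.
Variables (E : set T1) (c : R) (G : set (set U)).
Hypothesis mE : measurable E.
Hypothesis c0 : 0 <= c.
Hypothesis mG : measurable = <<s G >>.
Hypothesis GI : setI_closed G.
Hypothesis GT : G [set: U].
Hypothesis law : forall A, G A -> P1 (E `&` X @^-1` A) = (c%:E * P2 (Y @^-1` A))%E.

(** With [E] the whole space and [c = 1] this transports an equality in law; with [c] the
    probability of [E], the assumption is that [X] given [E] has the law of [Y]. Two finite measures
    that agree on the pi-system [G] are equal. *)
Lemma eq_law_integral (F : U -> \bar R) : measurable_fun [set: U] F ->
  (forall u, 0 <= F u)%E ->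
  (\int[P1]_(x in E) F (X x) = c%:E * \int[P2]_x F (Y x))%E.
Proof.
move=> mF F0.
pose m1 := mrestr P1 mE.
have -> : (\int[P1]_(x in E) F (X x) = \int[m1]_x F (X x))%E.
  have mFX : measurable_fun [set: T1] (F \o X) by exact: measurableT_comp.
  rewrite [RHS](ge0_negligible_integral (N := ~` E))//=.
  - rewrite setTD setCK; apply: eq_measure_integral => A mA AE.
    by rewrite [RHS](_ : _ = P1 (A `&` E))// setIidl.
  - exact: measurableC.
  - by rewrite /m1 /mrestr setICl measure0.
rewrite -(@ge0_integral_pushforward _ _ _ _ _ _ mX m1 setT F)//.
rewrite -(@ge0_integral_pushforward _ _ _ _ _ _ mY P2 setT F)//.
rewrite -(@ge0_integral_mscale _ _ _ (pushforward P2 Y) setT measurableT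
  (NngNum c0) F)//=.
apply: eq_measure_integral => A mA _.
apply: (@measure_unique _ _ _ G (fun=> setT)) => //.
- by apply/seteqP; split => // x _; exists 0%N.
- by move=> B GB; have := law GB; rewrite /= /pushforward /m1 /mrestr setIC => ->.
- move=> _; rewrite /= /pushforward /m1 /mrestr preimage_setT setTI.
  exact: le_lt_trans (probability_le1 P1 mE) (ltry _).
Qed.

Lemma eq_law_Rintegral (F : U -> R) : bounded_measurable F ->
  Rintegral P1 E (fun x => F (X x)) = c * Rintegral P2 [set: T2] (fun x => F (Y x)).
Proof.
move=> bF; have [mF [M FM]] := bF.
have ge0P (H : U -> R) : bounded_measurable H -> (forall u, 0 <= H u) ->
    Rintegral P1 E (H \o X) = c * Rintegral P2 [set: T2] (H \o Y).
  move=> bH H0; apply/EFin_inj; rewrite EFinM.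
  rewrite !bm_EFin_Rintegral//; [|exact: bm_comp..].
  by apply: (@eq_law_integral (EFin \o H)) => //; case: bH => ? _; exact/measurable_EFinP.
have bFM : bounded_measurable (fun u => F u + M) by apply: bmD => //; exact: bm_cst.
(* The case [F = 1] compares total masses; it removes the shift by [M] at the end. *)
have h1 := ge0P _ (bm_cst U (1 : R)) (fun=> ler01).
have h2 : Rintegral P1 E (fun x => F (X x) + M) =
    c * Rintegral P2 [set: T2] (fun x => F (Y x) + M).
  apply: (ge0P _ bFM) => u; rewrite -lerBlDr sub0r.
  by have := FM u; rewrite ler_norml => /andP[].
have bFX : bounded_measurable (fun x => F (X x)) by exact: (bm_comp bF mX).
have bFY : bounded_measurable (fun x => F (Y x)) by exact: (bm_comp bF mY).
move: h2; have aff d' (T : measurableType d') (P : probability T R) D f :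
    measurable D -> bounded_measurable f ->
    Rintegral P D (fun x => f x + M) = Rintegral P D f + M * Rintegral P D (fun=> 1).
  move=> mD bf; rewrite -bm_RintegralZl//; last exact: bm_cst.
  rewrite -RintegralD//; [|exact: bm_integrable|].
    by apply: eq_Rintegral => x _; rewrite mulr1.
  by apply: bm_integrable => //; exact: bm_cst.
rewrite !aff// [X in _ + M * X]h1 mulrDr [c * (M * _)]mulrCA.
by move/addIr.
Qed.

End Law.

Section Rectangles.
Context (R : realType) (n : nat).

Definition rectangles : set (set (n.-tuple R)) :=
  [set A | exists2 B : 'I_n -> set R, (forall i, measurable (B i)) &
           A = [set u | forall i, B i (tnth u i)]].

Lemma measurable_rectangles : measurable = <<s rectangles >>.
Proof.
apply/seteqP; split.
  apply: smallest_sub; first exact: smallest_sigma_algebra.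
  rewrite -bigcup_seq/= => A [i _ [C mC <-]].
  apply: sub_sigma_algebra; exists (fun j => if j == i then C else setT).
    by move=> j; case: ifP.
  apply/seteqP; split => u /=.
    by move=> [_ Cu] j; case: eqP => // ->.
  by move=> /(_ i); rewrite eqxx => Cu; split.
apply: smallest_sub; first exact: sigma_algebra_measurable.
move=> _ [B mB ->].
rewrite (_ : [set u | _] = \bigcap_(i in [set: 'I_n])
    ((fun u : n.-tuple R => tnth u i) @^-1` B i)); last first.
  by apply/seteqP; split => u /= H i; have := H i => //; exact.
apply: fin_bigcap_measurable => // i _.
by rewrite -[X in measurable X]setTI; apply: (measurable_tnth i).
Qed.

Lemma setI_closed_rectangles : setI_closed rectangles.
Proof.
move=> _ _ [B mB ->] [B' mB' ->]; exists (fun i => B i `&` B' i).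
  by move=> i; exact: measurableI.
apply/seteqP; split => u /=; first by move=> [H H'] i; split.
by move=> H; split => i; have [] := H i.
Qed.

Lemma rectanglesT : rectangles [set: n.-tuple R].
Proof. by exists (fun=> setT) => //; apply/seteqP; split. Qed.

End Rectangles.

Section Independence.
Context d (T : measurableType d) (R : realType) (P : probability T R).

Lemma independent_fin (I : Type) (E : I -> set (set T)) (K : finType)
    (k : K -> I) (A : K -> set T) :
  mutually_independent P E -> injective k -> (forall j, E (k j) (A j)) ->
  P (\bigcap_(j in [set: K]) A j) = (\prod_j fine (P (A j)))%:E.
Proof.
move=> indep kI EA.
have := @indep #|K| (k \o enum_val) _ (A \o enum_val) _.
rewrite (_ : \bigcap_(j in _) (A \o enum_val) j = \bigcap_(j in [set: K]) A j).
  move=> ->; [|exact: inj_comp kI enum_val_inj|by move=> j; exact: EA].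
  congr (_%:E); rewrite [RHS](reindex (enum_val : 'I_#|K| -> K))//.
  by exists enum_rank => x _; rewrite ?enum_rankK ?enum_valK.
apply/seteqP; split => t H j _ /=; last exact: H.
by have := H (enum_rank j) Logic.I; rewrite /= enum_rankK.
Qed.

Lemma sigma_of_preimage d' (T' : measurableType d') (X : T -> T') (B : set T') :
  measurable B -> sigma_of X (X @^-1` B).
Proof. by move=> mB; exists B => //; rewrite setTI. Qed.

End Independence.

(** * Parameters with countably many values *)

Lemma measurable_bool_comp d (T : measurableType d) (R : realType)
    (b : T -> bool) (F : bool -> R) : measurable_fun [set: T] b ->
  measurable_fun [set: T] (fun x => F (b x)).
Proof.
move=> mb; rewrite (_ : (fun x => _) = fun x => if b x then F true else F false).
  by apply: measurable_fun_ifT.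
by apply: funext => x; case: (b x).
Qed.

Lemma bm_bool d (T : measurableType d) (R : realType) (b : T -> bool)
    (F : bool -> R) : measurable_fun [set: T] b ->
  bounded_measurable (fun x => F (b x)).
Proof.
move=> mb; split; first exact: measurable_bool_comp.
exists (Num.max `|F true| `|F false|) => x.
by rewrite le_max; case: (b x); rewrite lexx ?orbT.
Qed.

Lemma measurable_countable_param d (T : measurableType d) d' (U : measurableType d')
    (I : countType) (e : T -> I) (F : I -> T -> U) :
  (forall i, measurable (e @^-1` [set i])) ->
  (forall i, measurable_fun [set: T] (F i)) ->
  measurable_fun [set: T] (fun x => F (e x) x).
Proof.
move=> me mF _ B mB; rewrite setTI.
rewrite (_ : _ @^-1` B = \bigcup_(n : nat)
    (if unpickle n is Some i then e @^-1` [set i] `&` F i @^-1` B else set0)).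
  apply: bigcup_measurable => n _; case: unpickle => // i.
  by apply: measurableI => //; rewrite -[X in measurable X]setTI; exact: mF.
apply/seteqP; split => [x /= Bx|x [n _]].
  by exists (pickle (e x)) => //; rewrite pickleK.
by case: unpickle => // i [/= ->].
Qed.

(** This serves to condition on the numbers of interactions and on the signs. *)
Lemma le_integral_fibers d (T : measurableType d) (R : realType)
    (mu : {measure set T -> \bar R}) (I : countType) (e : T -> I)
    (D : set T) (f g : T -> \bar R) :
  measurable D -> (forall i, measurable (D `&` e @^-1` [set i])) ->
  measurable_fun D f -> measurable_fun D g ->
  (forall x, 0 <= f x)%E -> (forall x, 0 <= g x)%E ->
  (forall i, \int[mu]_(x in D `&` e @^-1` [set i]) f x <=
             \int[mu]_(x in D `&` e @^-1` [set i]) g x)%E ->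
  (\int[mu]_(x in D) f x <= \int[mu]_(x in D) g x)%E.
Proof.
move=> mD me mf mg f0 g0 fg.
(* Several codes may decode to the same value; keeping the canonical one makes the pieces
   disjoint. *)
pose F n := if unpickle n is Some i then
  if pickle (i : I) == n then D `&` e @^-1` [set i] else set0 else set0.
have mF n : measurable (F n) by rewrite /F; case: unpickle => // i; case: ifP.
have DF : D = \bigcup_n F n.
  apply/seteqP; split => [x Dx|x [n _]].
    by exists (pickle (e x)) => //; rewrite /F pickleK eqxx.
  by rewrite /F; case: unpickle => // i; case: ifP => // _ [].
have tF : trivIset setT F.
  apply/trivIsetP => a b _ _ ab; apply/seteqP; split => // x [].
  rewrite /F; case: unpickle => // i; case: eqP => // ia [_ /= ei].
  case: unpickle => // j; case: eqP => // jb [_ /= ej].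
  by move: ab; rewrite -ia -jb -ei -ej eqxx.
rewrite DF in mf mg *; rewrite !ge0_integral_bigcup//.
apply: lee_nneseries => n _; first by move=> _; exact: integral_ge0.
rewrite /F; case: unpickle => [i|]; last by rewrite !integral_set0.
by case: ifP => // _; rewrite !integral_set0.
Qed.

(** Measurability is not part of [regular]; it comes from the approximating polynomials, taken with
    errors [1 / (n + 1)]. *)
Lemma bm_regular d (T : measurableType d) (R : realType) (m : nat)
    (Phi : (conf m -> R) -> R) (nu : T -> conf m -> R) :
  regular Phi -> (forall t, simplex (nu t)) ->
  (forall s, measurable_fun [set: T] (fun t => nu t s)) ->
  bounded_measurable (fun t => Phi (nu t)).
Proof.
move=> rP nuS mnu; have [M _ MP] := regular_bounded rP.
split; last by exists M => t; exact: MP.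
have e0 n : 0 < n.+1%:R^-1 :> R by rewrite invr_gt0.
pose l n := projT1 (cid (rP _ (e0 n))).
have lP n t : `|Phi (nu t) - moment_poly (l n) (nu t)| <= n.+1%:R^-1.
  by rewrite /l; case: cid => l0 /= /(_ (nu t) (nuS t)).
apply: (@measurable_fun_cvg _ _ _ _ (fun n t => moment_poly (l n) (nu t))).
  move=> n; apply: measurable_sum => x; apply: measurable_funM => //.
  elim: x.2 => [|C r IH].
    by under eq_fun do rewrite big_nil; exact: measurable_cst.
  under eq_fun do rewrite big_cons.
  apply: measurable_funM => //; apply: measurable_sum => s.
  exact: measurable_funM.
move=> t _; apply/cvgrPdist_le => e egt0.
have [N _ NP] := near_infty_natSinv_lt (PosNum egt0).
exists N => // n Nn /=; rewrite (le_trans (lP n t))// ltW//.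
exact: (NP n Nn).
Qed.

(** * Gibbs averages and exchangeability *)

Section SignBit.
Context (R : realType).
Implicit Types (sigma : R * R * R * R -> R) (y : R * R * R * R).

(* Off the cube the bit is [false], which extends [sigma] by 1 to a measurable
   sign function on the whole space. *)
Definition sign_bit sigma y : bool := `[< cube4 y /\ sigma y = -1 >].

Lemma sign_bitE sigma y : sign_function sigma -> cube4 y ->
  sigma y = (-1) ^+ sign_bit sigma y.
Proof.
move=> [_ s1] yc; rewrite /sign_bit; case: asboolP => [[_ ->]|H]; first by rewrite expr1.
by case: (s1 _ yc) => // s; case: H.
Qed.

Lemma measurable_cube4 : measurable (@cube4 R).
Proof.
have m01 : measurable [set x : R | 0 <= x <= 1].
  suff -> : [set x : R | 0 <= x <= 1] = `[0, 1]%classic by [].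
  by apply/seteqP; split => x /=; rewrite in_itv.
have pre (f : R * R * R * R -> R) : measurable_fun setT f ->
    measurable (f @^-1` [set x : R | 0 <= x <= 1]).
  by move=> mf; rewrite -[X in measurable X]setTI; exact: mf.
have m1 := pre (fun y => y.1.1.1) (measurableT_comp measurable_fst
  (measurableT_comp measurable_fst measurable_fst)).
have m2 := pre (fun y => y.1.1.2) (measurableT_comp measurable_snd
  (measurableT_comp measurable_fst measurable_fst)).
have m3 := pre (fun y => y.1.2) (measurableT_comp measurable_snd measurable_fst).
have m4 := pre (fun y => y.2) measurable_snd.
have := measurableI _ _ (measurableI _ _ m1 m2) (measurableI _ _ m3 m4).
congr (measurable _); apply/seteqP; split => y /=; first by move=> [[? ?] [? ?]].
by move=> [].
Qed.

Lemma measurable_sign_bit sigma : sign_function sigma ->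
  measurable_fun [set: R * R * R * R] (sign_bit sigma).
Proof.
move=> [ms _]; apply: (measurable_fun_bool true); rewrite setTI.
rewrite (_ : _ @^-1` _ = @cube4 R `&` sigma @^-1` [set -1]).
  by apply: ms => //; exact: measurable_cube4.
apply/seteqP; split => y /=; rewrite /sign_bit => H; first exact/asboolP.
by apply/asboolP.
Qed.

End SignBit.

Section Gibbs.
Context d d' (T : measurableType d) (T' : measurableType d') (R : realType).
Variables (P : probability T R) (P' : probability T' R).
Variables (p : nat) (D : disorder P p) (X : thermal P').
Variable tau : R * R * R * R -> bool.
Hypothesis mtau : measurable_fun [set: R * R * R * R] tau.
Hypothesis v_unif : forall s, uniform01 (dis_v D s).
Hypothesis w_unif : uniform01 (dis_w D).
Hypothesis D_indep : mutually_independent P (disorder_sigma D).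
Hypothesis X_law : thermal_law X.

Definition spin_bit (I : seq nat) (t : T) (t' : T') : bool :=
  tau (dis_w D t, th_u X t', dis_v D I t, th_x X I t').

Lemma measurable_spin_bit I :
  measurable_fun [set: T * T'] (fun z => spin_bit I z.1 z.2).
Proof.
apply: measurableT_comp => //; repeat apply: measurable_fun_pair => /=;
  exact: measurableT_comp.
Qed.

Definition spin_conf m (lab : 'I_m -> seq nat) t t' : conf m :=
  [ffun i => spin_bit (lab i) t t'].

(** The law, given the disorder, of the spins with labels [lab]: this is the random [nu] at which
    regular functions are evaluated. *)
Definition gibbs m (lab : 'I_m -> seq nat) (t : T) (s : conf m) : R :=
  Rintegral P' [set: T'] (fun t' => (spin_conf lab t t' == s)%:R).

Lemma eq_confE m (b : 'I_m -> bool) (s : conf m) :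
  ([ffun i => b i] == s)%:R = \prod_i (b i == s i)%:R :> R.
Proof.
have [<-|neq] := eqVneq [ffun i => b i] s.
  by rewrite big1// => i _; rewrite ffunE eqxx.
have [i si] : exists i, b i != s i.
  apply/existsP; apply: contraR neq => /existsPn H.
  by apply/eqP/ffunP => i; rewrite ffunE; apply/eqP; have := H i; rewrite negbK.
by rewrite (bigD1 i)//= (negbTE si) mul0r.
Qed.

Lemma bm_spin_conf m (lab : 'I_m -> seq nat) s :
  bounded_measurable (fun z : T * T' => (spin_conf lab z.1 z.2 == s)%:R : R).
Proof.
under eq_fun do rewrite eq_confE.
apply: bm_prod => i.
by apply: (bm_bool (fun b => (b == s i)%:R)); exact: measurable_spin_bit.
Qed.

Lemma bm_section (f : T * T' -> R) t : bounded_measurable f ->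
  bounded_measurable (fun t' => f (t, t')).
Proof. by move=> bf; apply: (@bm_comp _ _ _ _ _ f (pair t)). Qed.

Lemma gibbs_expectation m (lab : 'I_m -> seq nat) t (F : conf m -> R) :
  Rintegral P' [set: T'] (fun t' => F (spin_conf lab t t')) =
  \sum_s gibbs lab t s * F s.
Proof.
transitivity (Rintegral P' [set: T']
    (fun t' => \sum_s F s * (spin_conf lab t t' == s)%:R)).
  apply: eq_Rintegral => t' _; rewrite (bigD1 (spin_conf lab t t'))//= eqxx mulr1.
  rewrite big1 ?addr0// => s; rewrite eq_sym => /negbTE ->.
  by rewrite mulr0.
have bs s : bounded_measurable (fun t' => (spin_conf lab t t' == s)%:R : R).
  exact: (bm_section t (bm_spin_conf lab s)).
rewrite bm_Rintegral_sum//; last by move=> s; apply: bmM => //; exact: bm_cst.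
by apply: eq_bigr => s _; rewrite bm_RintegralZl// mulrC.
Qed.

Lemma gibbs_simplex m (lab : 'I_m -> seq nat) t : simplex (gibbs lab t).
Proof.
split; first by move=> s; apply: Rintegral_ge0.
under eq_bigr do rewrite -[gibbs _ _ _]mulr1.
by rewrite -(gibbs_expectation lab t (fun=> 1)) probability_Rintegral_cst.
Qed.

Lemma bm_gibbs m (lab : 'I_m -> seq nat) s :
  bounded_measurable (fun t => gibbs lab t s).
Proof. exact: (bm_fubini P' (bm_spin_conf lab s)). Qed.

Lemma bm_regular_gibbs m (lab : 'I_m -> seq nat) (Phi : (conf m -> R) -> R) :
  regular Phi -> bounded_measurable (fun t => Phi (gibbs lab t)).
Proof.
move=> rP; apply: bm_regular => // [t|s]; first exact: gibbs_simplex.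
by have [] := bm_gibbs lab s.
Qed.

Section Exchange.
Variable m : nat.
Implicit Type lab : 'I_m -> seq nat.

(** Coordinate 0 is the variable [w] shared by all spins, and coordinate [i + 1] the variable
    attached to the label of [i]; [thermal_coord] follows the same pattern with [u]. *)
Definition disorder_coord lab (k : 'I_m.+1) : {RV P >-> R} :=
  if unlift ord0 k is Some i then dis_v D (lab i) else dis_w D.

Definition thermal_coord lab (k : 'I_m.+1) : thermal_index :=
  if unlift ord0 k is Some i then Index_x (lab i) else Index_u.

Definition disorder_point lab t : m.+1.-tuple R :=
  [tuple disorder_coord lab k t | k < m.+1].

Definition thermal_point lab t' : m.+1.-tuple R :=
  [tuple thermal_var X (thermal_coord lab k) t' | k < m.+1].

Lemma measurable_disorder_point lab : measurable_fun [set: T] (disorder_point lab).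
Proof.
apply/measurable_fun_tnthP => k.
rewrite (_ : _ \o _ = disorder_coord lab k); first exact: measurable_funP.
by apply: funext => t /=; rewrite tnth_mktuple.
Qed.

Lemma measurable_thermal_point lab : measurable_fun [set: T'] (thermal_point lab).
Proof.
apply/measurable_fun_tnthP => k.
rewrite (_ : _ \o _ = thermal_var X (thermal_coord lab k)); first exact: measurable_funP.
by apply: funext => t /=; rewrite tnth_mktuple.
Qed.

Definition conf_at (s : conf m) (zx : m.+1.-tuple R * m.+1.-tuple R) : R :=
  \prod_i (tau (tnth zx.1 ord0, tnth zx.2 ord0,
               tnth zx.1 (lift ord0 i), tnth zx.2 (lift ord0 i)) == s i)%:R.

Lemma bm_conf_at s : bounded_measurable (conf_at s).
Proof.
apply: bm_prod => i; apply: (bm_bool (fun b => (b == s i)%:R)).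
apply: measurableT_comp => //; repeat apply: measurable_fun_pair => /=;
by apply: (measurableT_comp (measurable_tnth _)).
Qed.

Lemma spin_conf_at lab t t' s :
  (spin_conf lab t t' == s)%:R =
  conf_at s (disorder_point lab t, thermal_point lab t').
Proof.
rewrite eq_confE; apply: eq_bigr => i _; rewrite !tnth_mktuple.
by rewrite /disorder_coord /thermal_coord unlift_none liftK.
Qed.

Lemma thermal_coord_inj lab : injective lab -> injective (thermal_coord lab).
Proof.
move=> labI k k'; rewrite /thermal_coord.
case: (unliftP ord0 k) => [i ->|->]; case: (unliftP ord0 k') => [j ->|->] //.
by move=> [/labI ->].
Qed.

Lemma thermal_rectangle lab (B : 'I_m.+1 -> set R) : injective lab ->
  (forall k, measurable (B k)) ->
  P' (thermal_point lab @^-1` [set u | forall k, B k (tnth u k)]) =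
  (\prod_k fine (uniform_prob (@ltr01 R) (B k)))%:E.
Proof.
move=> labI mB; have [unif indep] := X_law.
transitivity (P' (\bigcap_(k in [set: 'I_m.+1])
    (thermal_var X (thermal_coord lab k) @^-1` B k))).
  congr (P' _); apply/seteqP; split => t /= H k; last first.
    by rewrite tnth_mktuple; exact: H.
  by move=> _; have := H k; rewrite tnth_mktuple.
rewrite (independent_fin indep (thermal_coord_inj labI)); last first.
  by move=> k; exact: sigma_of_preimage.
by congr (_%:E); apply: eq_bigr => k _; have [_ <-] := unif (thermal_coord lab k).
Qed.

Lemma thermal_exchange lab lab' (F : m.+1.-tuple R -> R) :
  injective lab -> injective lab' -> bounded_measurable F ->
  Rintegral P' [set: T'] (fun t' => F (thermal_point lab t')) =
  Rintegral P' [set: T'] (fun t' => F (thermal_point lab' t')).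
Proof.
move=> labI labI' bF.
rewrite -[RHS]mul1r.
apply: (@eq_law_Rintegral _ _ _ _ _ _ _ P' P' _ _ _ _ setT 1
  (@rectangles R m.+1)) => //.
- exact: measurable_thermal_point.
- exact: measurable_thermal_point.
- exact: measurable_rectangles.
- exact: setI_closed_rectangles.
- exact: rectanglesT.
- by move=> _ [B mB ->]; rewrite setTI mul1e !thermal_rectangle.
Qed.

Definition environment_index (i : disorder_index p) : bool :=
  match i with Index_J _ _ _ | Index_pi _ => true | _ => false end.

(** Such an event involves finitely many signs and numbers of interactions, hence is independent of
    [w] and of the variables [v]. *)
Definition environment_event (E : set T) : Prop :=
  exists (K : finType) (k : K -> disorder_index p) (A : K -> set T),
    [/\ injective k, forall j, environment_index (k j),
        forall j, disorder_sigma D (k j) (A j) &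
        E = \bigcap_(j in [set: K]) A j].

Definition disorder_coord_index lab (k : 'I_m.+1) : disorder_index p :=
  if unlift ord0 k is Some i then Index_v p (lab i) else Index_w p.

Lemma disorder_coord_index_inj lab :
  injective lab -> injective (disorder_coord_index lab).
Proof.
move=> labI k k'; rewrite /disorder_coord_index.
case: (unliftP ord0 k) => [i ->|->]; case: (unliftP ord0 k') => [j ->|->] //.
by move=> [/labI ->].
Qed.

Lemma disorder_rectangle E lab (B : 'I_m.+1 -> set R) : environment_event E ->
  injective lab -> (forall k, measurable (B k)) ->
  P (E `&` disorder_point lab @^-1` [set u | forall k, B k (tnth u k)]) =
  (fine (P E) * \prod_k fine (uniform_prob (@ltr01 R) (B k)))%:E.
Proof.
move=> [K [e [A [eI eenv eA ->]]]] labI mB.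
pose idx (j : K + 'I_m.+1) :=
  match j with inl j => e j | inr k => disorder_coord_index lab k end.
pose ev (j : K + 'I_m.+1) :=
  match j with inl j => A j | inr k => disorder_coord lab k @^-1` B k end.
have notenv k : environment_index (disorder_coord_index lab k) = false.
  by rewrite /disorder_coord_index; case: unlift.
have idxI : injective idx.
  move=> [j|k] [j'|k'] /=; first by move=> /eI ->.
  - by move=> ee; have := eenv j; rewrite ee notenv.
  - by move=> ee; have := eenv j'; rewrite -ee notenv.
  - by move=> /(disorder_coord_index_inj labI) ->.
have evP j : disorder_sigma D (idx j) (ev j).
  case: j => [j|k] /=; first exact: eA.
  rewrite /disorder_coord_index /disorder_coord; case: unlift => [i|] /=;
  exact: sigma_of_preimage.
transitivity (P (\bigcap_(j in [set: K + 'I_m.+1]) ev j)).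
  congr (P _); apply/seteqP; split => t /=.
    move=> [HA HB] [j|k] _ /=; first exact: HA.
    by have := HB k; rewrite tnth_mktuple.
  move=> H; split => [j _|k]; first exact: (H (inl j)).
  by rewrite tnth_mktuple; exact: (H (inr k)).
rewrite (independent_fin D_indep idxI evP) (independent_fin D_indep eI eA)/=.
congr (_%:E); rewrite big_sumType/=; congr (_ * _); apply: eq_bigr => k _.
rewrite /disorder_coord; case: unlift => [i|] /=.
  by have [_ <-] := v_unif (lab i).
by have [_ <-] := w_unif.
Qed.

Lemma environment_eventT : environment_event [set: T].
Proof.
exists void, (of_void _), (of_void _).
by split; [case|case|case|apply/seteqP; split => // t _ []].
Qed.

Lemma measurable_disorder_sigma i A : disorder_sigma D i A -> measurable A.
Proof.
by case: i => [|s|s|k i j|k j|i] [B mB <-]; apply: measurable_funP.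
Qed.

Lemma measurable_environment_event E : environment_event E -> measurable E.
Proof.
move=> [K [e [A [_ _ eA ->]]]]; apply: fin_bigcap_measurable => // j _.
exact: measurable_disorder_sigma (eA j).
Qed.

(** The law of the spins is a fixed function of [w] and of the [v] at their labels. Distinct labels
    carry i.i.d. variables independent of the environment, so neither the labels nor conditioning on
    [E] affect its distribution. *)
Lemma gibbs_exchange E lab lab' (Phi : (conf m -> R) -> R) :
  environment_event E -> injective lab -> injective lab' -> regular Phi ->
  Rintegral P E (fun t => Phi (gibbs lab t)) =
  fine (P E) * Rintegral P [set: T] (fun t => Phi (gibbs lab' t)).
Proof.
move=> envE labI labI' rP.
(* The thermal variables are taken along [lab'] whatever the labels of the spins; [thermal_exchange]
   shows that the integral is the same. *)
pose nu (z : m.+1.-tuple R) (s : conf m) : R :=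
  Rintegral P' [set: T'] (fun t' => conf_at s (z, thermal_point lab' t')).
have gibbsE l t : injective l -> gibbs l t = nu (disorder_point l t).
  move=> lI; apply: funext => s; rewrite /gibbs /nu.
  under eq_Rintegral do rewrite spin_conf_at.
  apply: (thermal_exchange lI labI' (F := fun x => conf_at s (disorder_point l t, x))).
  by apply: (@bm_comp _ _ _ _ _ (conf_at s) (pair _)) => //; exact: bm_conf_at.
have bnu s : bounded_measurable (nu^~ s).
  apply: (bm_fubini P' (f := fun zx => conf_at s (zx.1, thermal_point lab' zx.2))).
  apply: (@bm_comp _ _ _ _ _ (conf_at s) (fun zx => (zx.1, thermal_point lab' zx.2))).
    exact: bm_conf_at.
  apply: measurable_fun_pair => //; apply: measurableT_comp => //.
  exact: measurable_thermal_point.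
have nuS z : simplex (nu z).
  split=> [s|]; first by apply: Rintegral_ge0 => t' _; apply: prodr_ge0.
  rewrite -bm_Rintegral_sum//; last first.
    move=> s; apply: (@bm_comp _ _ _ _ _ (conf_at s)
      (fun t' => (z, thermal_point lab' t'))).
      exact: bm_conf_at.
    by apply: measurable_fun_pair => //; exact: measurable_thermal_point.
  rewrite -[RHS](@probability_Rintegral_cst _ _ _ P'); apply: eq_Rintegral => t' _.
  pose b i := tau (tnth z ord0, tnth (thermal_point lab' t') ord0,
    tnth z (lift ord0 i), tnth (thermal_point lab' t') (lift ord0 i)).
  under eq_bigr => s _ do rewrite /conf_at/= -(eq_confE b).
  rewrite (bigD1 [ffun i => b i])//= eqxx big1 ?addr0// => s.
  by rewrite eq_sym => /negbTE ->.
have bP : bounded_measurable (fun z => Phi (nu z)).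
  by apply: bm_regular => // s; have [] := bnu s.
have mE := measurable_environment_event envE.
transitivity (Rintegral P E (fun t => Phi (nu (disorder_point lab t)))).
  by apply: eq_Rintegral => t _; rewrite gibbsE.
rewrite [X in _ * X](_ : _ = Rintegral P setT
    (fun t => Phi (nu (disorder_point lab' t)))); last first.
  by apply: eq_Rintegral => t _; rewrite gibbsE.
apply: (@eq_law_Rintegral _ _ _ _ _ _ _ P P _ _ _ _ E _ (@rectangles R m.+1)
  _ _ _ _ _ _ (fun z => Phi (nu z))) => //.
- exact: measurable_disorder_point.
- exact: measurable_disorder_point.
- exact: fine_ge0.
- exact: measurable_rectangles.
- exact: setI_closed_rectangles.
- exact: rectanglesT.
- move=> _ [B mB ->]; rewrite disorder_rectangle//.
  have := disorder_rectangle environment_eventT labI' mB.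
  by rewrite setTI probability_setT mul1r EFinM => ->; rewrite fineK// fin_num_measure.
Qed.

End Exchange.
End Gibbs.

(** * The cavity recursion *)

Section Recursion.
Context d d' (T : measurableType d) (T' : measurableType d') (R : realType).
Variables (P : probability T R) (P' : probability T' R).
Variables (p : nat) (alpha beta : R) (D : disorder P p) (X : thermal P').
Variable sigma : R * R * R * R -> R.
Hypothesis p_gt0 : (0 < p)%N.
Hypothesis alpha_gt0 : 0 < alpha.
Hypothesis beta_gt0 : 0 < beta.
Hypothesis D_law : disorder_law alpha D.
Hypothesis X_law : thermal_law X.
Hypothesis sign_sigma : sign_function sigma.
Hypothesis cavity : forall n m q r : nat,
  (1 <= n)%N -> (n <= m)%N -> (1 <= q)%N ->
  forall C : 'I_q -> {set 'I_m}, cavity_equation beta D X sigma n r C.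

Local Notation tau := (sign_bit sigma).
Local Notation G := (gibbs D X tau).

Let mtau : measurable_fun [set: R * R * R * R] tau.
Proof. exact: measurable_sign_bit. Qed.

Lemma spinE I t t' : spin D X sigma I t t' = (-1) ^+ spin_bit D X tau I t t'.
Proof.
rewrite /spin sign_bitE//; split => /=.
- by have [+ _] := law_w D_law; exact.
- by have [+ _] := X_law => /(_ Index_u)[+ _]; exact.
- by have [+ _] := law_v D_law I; exact.
- by have [+ _] := X_law => /(_ (Index_x I))[+ _]; exact.
Qed.

(** * Interactions with given degrees and signs *)

Section Environment.
Variables (m K : nat).

Definition environment := {ffun 'I_K * 'I_m * 'I_p -> bool}.

Local Notation N := #|{: neighbor m K p}|.

Definition interaction (b : environment) (i : 'I_m) (k : 'I_K) (a : bool)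
    (S : conf N) : R :=
  expR (theta beta (fun j => b (k, i, j))
    (fun j => if (j < p.-1)%N then (-1) ^+ S (site i k j) else (-1) ^+ a)).

(** The exponential of [theta] is affine in a product of numbers of [[0, 1]], with values 1 and
    [expR (- beta)] at the two ends. *)
Lemma expR_theta (J : 'I_p -> bool) (s : 'I_p -> R) :
  (forall j, `|s j| <= 1) -> expR (- beta) <= expR (theta beta J s) <= 1.
Proof.
move=> s1; set y := \prod_(i < p) ((1 + (-1) ^+ J i * s i) / 2).
have y01 : 0 <= y <= 1.
  have f01 i : 0 <= (1 + (-1) ^+ J i * s i) / 2 <= 1.
    have : `|(-1) ^+ J i * s i| <= 1 by rewrite normrM normrX normrN1 expr1n mul1r.
    by rewrite ler_norml => /andP[a b]; apply/andP; split; lra.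
  rewrite prodr_ge0 => [/=|i _]; last by have /andP[] := f01 i.
  by apply: prodr_ile1 => i _; exact: f01.
have /andP[y0 y1] := y01.
have e1 : expR (- beta) < 1 by rewrite expR_lt1 oppr_lt0.
have e0 : 0 < expR (- beta) := expR_gt0 _.
have lo : expR (- beta) <= 1 + (expR (- beta) - 1) * y.
  have : 0 <= (1 - expR (- beta)) * (1 - y).
    by apply: mulr_ge0; rewrite subr_ge0// ltW.
  by nra.
have hi : 1 + (expR (- beta) - 1) * y <= 1.
  have : 0 <= (1 - expR (- beta)) * y by rewrite mulr_ge0// subr_ge0 ltW.
  by nra.
by rewrite /theta -/y lnK ?lo// posrE (lt_le_trans e0).
Qed.

Lemma expRNbeta01 : 0 < expR (- beta) < 1.
Proof. by rewrite expR_gt0 expR_lt1 oppr_lt0. Qed.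

Lemma interactionP b i k a S : expR (- beta) <= interaction b i k a S <= 1.
Proof.
apply: expR_theta => j.
by case: ifP => _; rewrite normrX normrN1 expr1n.
Qed.

Lemma interaction_local b i k a (S S' : conf N) :
  (forall j : 'I_p, (j < p.-1)%N -> S (site i k j) = S' (site i k j)) ->
  interaction b i k a S = interaction b i k a S'.
Proof.
move=> SS'; congr (expR (theta _ _ _)); apply: funext => j.
by case: ifPn => // jp; rewrite SS'.
Qed.

Definition neighbor_label (y : 'I_N) : seq nat :=
  [:: val (coords y).2; val (coords y).1.1; val (coords y).1.2].

Lemma neighbor_label_inj : injective neighbor_label.
Proof.
move=> y y' [/val_inj e1 /val_inj e2 /val_inj e3]; apply: enum_val_inj.
rewrite -/(coords y) -/(coords y').
rewrite (surjective_pairing (coords y)) (surjective_pairing (coords y')).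
by rewrite (surjective_pairing (coords y).1) (surjective_pairing (coords y').1) e1 e2 e3.
Qed.

Definition environment_at (t : T) : environment :=
  [ffun x : 'I_K * 'I_m * 'I_p => dis_J D x.1.1 x.1.2 x.2 t].

Lemma exp_cavity_field (kappa : 'I_m -> nat) (s : conf m) t t' :
  (forall i : 'I_m, dis_pi D i t = kappa i) -> (forall i, (kappa i <= K)%N) ->
  expR (\sum_(i < m) cavity_field beta D X sigma i ((-1) ^+ s i) t t') =
  cavity_weight kappa (interaction (environment_at t)) s
    (spin_conf D X tau neighbor_label t t').
Proof.
move=> piE kK; rewrite expR_sum; apply: eq_bigr => i _.
rewrite /cavity_field piE expR_sum.
rewrite (big_ord_widen K (fun k => expR (theta beta (fun j => dis_J D k i j t)
  (fun j : 'I_p => if (j < p.-1)%N then spin D X sigma [:: val j; val i; k] t t'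
                   else (-1) ^+ s i))) (kK i)).
apply: eq_bigr => k _; rewrite /interaction.
have -> : (fun j => environment_at t (k, i, j)) = (fun j => dis_J D k i j t).
  by apply: funext => j; rewrite ffunE.
have -> // : (fun j : 'I_p => if (j < p.-1)%N
      then (-1) ^+ spin_conf D X tau neighbor_label t t' (site i k j)
      else (-1) ^+ s i) =
    (fun j : 'I_p => if (j < p.-1)%N then spin D X sigma [:: val j; val i; val k] t t'
      else (-1) ^+ s i).
by apply: funext => j; rewrite ffunE spinE /neighbor_label siteK.
Qed.

End Environment.

Lemma bm_conf_fun m (lab : 'I_m -> seq nat) t (F : conf m -> R) :
  bounded_measurable (fun t' => F (spin_conf D X tau lab t t')).
Proof.
rewrite (_ : (fun t' => _) = fun t' =>
    \sum_s F s * (spin_conf D X tau lab t t' == s)%:R).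
  apply: bm_sum => s; apply: bmM; first exact: bm_cst.
  exact: (bm_section t (bm_spin_conf D X mtau lab s)).
apply: funext => t'; rewrite (bigD1 (spin_conf D X tau lab t t'))//= eqxx mulr1.
by rewrite big1 ?addr0// => s; rewrite eq_sym => /negbTE ->; rewrite mulr0.
Qed.

(** * The cavity equations as an invariance of the law of the spins *)

Section Fixed.
Variable m : nat.
Hypothesis m_gt0 : (0 < m)%N.

Definition standard_label (i : 'I_m) : seq nat := [:: val i].

Definition degrees (t : T) : {ffun 'I_m -> nat} := [ffun i : 'I_m => dis_pi D i t].

(** A common range for the interactions of all sites: the finite family of neighbors has to be fixed
    before their joint law can be considered. *)
Definition max_degree (kappa : {ffun 'I_m -> nat}) : nat := \max_i kappa i.

Definition mass (t : T) (s : conf m) : R :=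
  Rintegral P' [set: T'] (fun t' =>
    expR (\sum_(i < m) cavity_field beta D X sigma i ((-1) ^+ s i) t t')).

(** The law of the spins after one cavity step with the random degrees and signs at [t];
    [cavity_map] is its version with degrees and signs as parameters. *)
Definition new_gibbs (t : T) (s : conf m) : R := mass t s / \sum_s' mass t s'.

Lemma bm_exp_cavity_field t (s : conf m) : bounded_measurable (fun t' =>
  expR (\sum_(i < m) cavity_field beta D X sigma i ((-1) ^+ s i) t t')).
Proof.
pose kappa := degrees t.
rewrite (_ : (fun t' => _) = fun t' =>
    cavity_weight kappa (interaction (environment_at m (max_degree kappa) t)) s
      (spin_conf D X tau (@neighbor_label m (max_degree kappa)) t t')).
  exact: bm_conf_fun.
apply: funext => t'; apply: exp_cavity_field => i; first by rewrite ffunE.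
exact: (leq_bigmax i).
Qed.

Lemma massE t s kappa : degrees t = kappa ->
  mass t s = cavity_mass kappa
    (interaction (environment_at m (max_degree kappa) t)) s
    (G (@neighbor_label m (max_degree kappa)) t).
Proof.
move=> dk; rewrite /cavity_mass -(gibbs_expectation D X mtau).
apply: eq_Rintegral => t' _; apply: exp_cavity_field => i.
  by rewrite -dk ffunE.
exact: (leq_bigmax i).
Qed.

Lemma new_gibbsE t kappa : degrees t = kappa ->
  new_gibbs t = cavity_map kappa
    (interaction (environment_at m (max_degree kappa) t))
    (G (@neighbor_label m (max_degree kappa)) t).
Proof.
move=> dk; apply: funext => s; rewrite /new_gibbs (massE s dk).
by under eq_bigr do rewrite (massE _ dk).
Qed.

Lemma new_gibbs_simplex t : simplex (new_gibbs t).
Proof.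
rewrite (new_gibbsE (erefl (degrees t))).
apply: (cavity_map_simplex _ expRNbeta01 (interactionP _)).
exact: gibbs_simplex.
Qed.

(** With [n = m] every spin is renewed and the product over the old spins is empty; with [r = 0] the
    factor of [theta_hat_sum] is 1. *)
Lemma cavity_UE (C : {set 'I_m}) t :
  cavity_U beta D X sigma m 0 C t = (\sum_s chi R C s * mass t s) / 2 ^+ m.
Proof.
have bE s := bm_exp_cavity_field t s.
transitivity (Rintegral P' [set: T'] (fun t' =>
    (2 ^+ m)^-1 * \sum_(s : conf m) chi R C s *
      expR (\sum_(i < m) cavity_field beta D X sigma i ((-1) ^+ s i) t t'))).
  apply: eq_Rintegral => t' _.
  rewrite /theta_hat_sum big_ord0 expR0 mulr1 [X in _ * X]big_pred0; last first.
    by move=> i; rewrite leqNgt ltn_ord andbF.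
  rewrite mulr1 /sign_average mulrC; congr (_ * _); apply: eq_bigr => s _.
  congr (_ * expR _); apply: eq_bigl => i; rewrite ltn_ord ?andbT//.
rewrite bm_RintegralZl//; last first.
  by apply: bm_sum => s; apply: bmM => //; exact: bm_cst.
rewrite mulrC; congr (_ * _); rewrite bm_Rintegral_sum//; last first.
  by move=> s; apply: bmM => //; exact: bm_cst.
by apply: eq_bigr => s _; rewrite bm_RintegralZl.
Qed.

Lemma cavity_VE t : cavity_V beta D X sigma m m 0 t = (\sum_s mass t s) / 2 ^+ m.
Proof.
have bE s := bm_exp_cavity_field t s.
transitivity (Rintegral P' [set: T'] (fun t' =>
    (2 ^+ m)^-1 * \sum_(s : conf m)
      expR (\sum_(i < m) cavity_field beta D X sigma i ((-1) ^+ s i) t t'))).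
  apply: eq_Rintegral => t' _.
  rewrite /theta_hat_sum big_ord0 expR0 mulr1.
  rewrite /sign_average mulrC; congr (_ * _); apply: eq_bigr => s _.
  by congr (expR _); apply: eq_bigl => i; rewrite ltn_ord.
rewrite bm_RintegralZl//; last exact: bm_sum.
by rewrite mulrC bm_Rintegral_sum.
Qed.

Lemma mass_sum_neq0 t : \sum_s mass t s != 0.
Proof.
(* Were the sum 0, the convention [0^-1 = 0] would make [new_gibbs] vanish identically, against its
   total mass 1. *)
apply/eqP => s0; have [_ ] := new_gibbs_simplex t.
rewrite /new_gibbs s0; under eq_bigr do rewrite invr0 mulr0.
by rewrite big1// => /esym/eqP; rewrite oner_eq0.
Qed.

Lemma cavity_moments (l : seq {set 'I_m}) :
  Rintegral P [set: T] (fun t => \prod_(C <- l) moment (G standard_label t) C) =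
  Rintegral P [set: T] (fun t => \prod_(C <- l) moment (new_gibbs t) C).
Proof.
(* The cavity equations require [q >= 1]; for [q = 0] both products are empty. *)
case: l => [|C0 l0]; first by apply: eq_Rintegral => t _; rewrite !big_nil.
set l := C0 :: l0.
have := @cavity m m (size l) 0 m_gt0 (leqnn m) isT (tnth (in_tuple l)).
rewrite /cavity_equation => E.
transitivity (Rintegral P [set: T] (fun t => \prod_(j < size l)
  E' P' (fun t' => \prod_(i in tnth (in_tuple l) j) spin D X sigma [:: val i] t t'))).
  apply: eq_Rintegral => t _; rewrite big_tnth; apply: eq_bigr => j _.
  rewrite /moment; under eq_bigr do rewrite mulrC.
  rewrite -(gibbs_expectation D X mtau); apply: eq_Rintegral => t' _.
  by apply: eq_bigr => i _; rewrite spinE ffunE.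
rewrite {}E; apply: eq_Rintegral => t _.
rewrite [RHS]big_tnth cavity_VE -[X in _ ^+ X](card_ord (size l)) -prodr_const.
rewrite -prodf_div; apply: eq_bigr => j _.
rewrite cavity_UE /moment /new_gibbs.
have n0 := mass_sum_neq0 t.
under [RHS]eq_bigr do rewrite mulrA.
rewrite -mulr_suml; field.
by rewrite n0 expf_neq0// pnatr_eq0.
Qed.

Lemma measurable_degrees kappa : measurable (degrees @^-1` [set kappa]).
Proof.
rewrite (_ : _ @^-1` _ = \bigcap_(i in [set: 'I_m]) (dis_pi D i @^-1` [set kappa i])).
  apply: fin_bigcap_measurable => // i _.
  by rewrite -[X in measurable X]setTI; apply: measurable_funP.
apply/seteqP; split => t /=; first by move=> <- i _; rewrite /= ffunE.
by move=> H; apply/ffunP => i; rewrite ffunE; exact: (H i).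
Qed.

Lemma measurable_environment_at K b :
  measurable (environment_at m K @^-1` [set b]).
Proof.
rewrite (_ : _ @^-1` _ = \bigcap_(x in [set: 'I_K * 'I_m * 'I_p])
    (dis_J D x.1.1 x.1.2 x.2 @^-1` [set b x])).
  apply: fin_bigcap_measurable => // x _.
  by rewrite -[X in measurable X]setTI; apply: measurable_funP.
apply/seteqP; split => t /=; first by move=> <- x _; rewrite /= ffunE.
by move=> H; apply/ffunP => x; rewrite ffunE; exact: (H x).
Qed.

Lemma environment_event_fiber K (kappa : {ffun 'I_m -> nat}) (b : environment m K) :
  environment_event D
    (degrees @^-1` [set kappa] `&` environment_at m K @^-1` [set b]).
Proof.
exists ('I_m + 'I_K * 'I_m * 'I_p)%type.
exists (fun j : 'I_m + 'I_K * 'I_m * 'I_p => match j with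
  | inl i => Index_pi p (val i)
  | inr x => Index_J (val x.1.1) (val x.1.2) x.2 end).
exists (fun j : 'I_m + 'I_K * 'I_m * 'I_p => match j with
  | inl i => dis_pi D i @^-1` [set kappa i]
  | inr x => dis_J D x.1.1 x.1.2 x.2 @^-1` [set b x] end).
split.
- move=> [i|[[k i] j]] [i'|[[k' i'] j']] //=; first by move=> [/val_inj ->].
  by move=> [/val_inj -> /val_inj -> ->].
- by case.
- by case=> [i|x] /=; exact: sigma_of_preimage.
- apply/seteqP; split => t /=.
    by move=> [<- <-] [i|x] _ /=; rewrite ffunE.
  move=> H; split; apply/ffunP => x; rewrite ffunE; first exact: (H (inl x)).
  exact: (H (inr x)).
Qed.

(** Fixing the degrees, then the signs, leaves a regular function of a Gibbs law. *)
Lemma measurable_new_gibbs s : measurable_fun [set: T] (new_gibbs^~ s).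
Proof.
pose H (kappa : {ffun 'I_m -> nat}) t :=
  cavity_map kappa (interaction (environment_at m (max_degree kappa) t))
    (G (@neighbor_label m (max_degree kappa)) t) s.
rewrite (_ : new_gibbs^~ s = fun t => H (degrees t) t); last first.
  by apply: funext => t; rewrite (new_gibbsE (erefl (degrees t))).
apply: (measurable_countable_param (F := H) measurable_degrees) => kappa.
pose F (b : environment m (max_degree kappa)) t := cavity_map kappa (interaction b)
    (G (@neighbor_label m (max_degree kappa)) t) s.
apply: (measurable_countable_param (F := F) (@measurable_environment_at _)) => b.
have rF : regular (fun nu => cavity_map kappa (interaction b) nu s).
  exact: (regular_cavity_map _ expRNbeta01 (interactionP _)).
by have [] := bm_regular_gibbs D X mtau (@neighbor_label m (max_degree kappa)) rF.
Qed.

(** Equality of the mixed moments passes to polynomials by linearity and to regular functions by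
    uniform approximation. *)
Lemma cavity_regular (Phi : (conf m -> R) -> R) : regular Phi ->
  Rintegral P [set: T] (fun t => Phi (G standard_label t)) =
  Rintegral P [set: T] (fun t => Phi (new_gibbs t)).
Proof.
move=> rP; pose g := G standard_label.
have gS t : simplex (g t) by exact: gibbs_simplex.
have bg Psi : regular Psi -> bounded_measurable (fun t => Psi (g t)).
  by move=> rPsi; exact: bm_regular_gibbs.
have bn Psi : regular Psi -> bounded_measurable (fun t => Psi (new_gibbs t)).
  move=> rPsi; apply: bm_regular => //; first exact: new_gibbs_simplex.
  exact: measurable_new_gibbs.
have rprod (r : seq {set 'I_m}) : regular (fun nu => \prod_(C <- r) moment nu C : R).
  by apply: regular_prod => C; exact: regular_moment.
have polyE l : Rintegral P [set: T] (fun t => moment_poly l (g t)) =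
    Rintegral P [set: T] (fun t => moment_poly l (new_gibbs t)).
  rewrite !bm_Rintegral_sum//; last 2 first.
  - move=> x; apply: (bn (fun nu => x.1 * \prod_(C <- x.2) moment nu C)).
    by apply: regularM => //; exact: regular_cst.
  - move=> x; apply: (bg (fun nu => x.1 * \prod_(C <- x.2) moment nu C)).
    by apply: regularM => //; exact: regular_cst.
  apply: eq_bigr => x _; rewrite !bm_RintegralZl//; last 2 first.
  - exact: (bn _ (rprod _)).
  - exact: (bg _ (rprod _)).
  by rewrite cavity_moments.
have close l e (nu : T -> conf m -> R) : (forall t, simplex (nu t)) ->
    (forall Psi, regular Psi -> bounded_measurable (fun t => Psi (nu t))) ->
    (forall mu, simplex mu -> `|Phi mu - moment_poly l mu| <= e) ->
    `|Rintegral P [set: T] (fun t => Phi (nu t)) -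
      Rintegral P [set: T] (fun t => moment_poly l (nu t))| <= e.
  move=> nuS bnu lP; have rl := regular_moment_poly l.
  have b1 := bnu _ (regularB rP rl); have b2 := bnu _ rP; have b3 := bnu _ rl.
  rewrite -RintegralB//; [|exact: bm_integrable..].
  rewrite ler_norml; apply/andP; split.
    rewrite -[leLHS](@probability_Rintegral_cst _ _ _ P).
    apply: bm_le_Rintegral => //; first exact: bm_cst.
    by move=> t _; have := lP _ (nuS t); rewrite ler_norml => /andP[].
  rewrite -[leRHS](@probability_Rintegral_cst _ _ _ P).
  apply: bm_le_Rintegral => //; first exact: bm_cst.
  by move=> t _; have := lP _ (nuS t); rewrite ler_norml => /andP[].
apply/eqP; rewrite -subr_eq0 -normr_le0; apply/ler_addgt0Pl => e e0.
have e20 : 0 < e / 2 by rewrite divr_gt0.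
have [l lP] := rP _ e20.
have h1 := close l (e / 2) g gS bg lP.
have h2 := close l (e / 2) new_gibbs new_gibbs_simplex bn lP.
rewrite addr0 [e]splitr.
rewrite (le_trans (ler_distD (Rintegral P setT (fun t => moment_poly l (g t))) _ _))//.
by rewrite lerD// polyE distrC.
Qed.

End Fixed.
End Recursion.

(** Since [k.+1 * a k.+1 = rate * a k], a partial sum of the mean is [rate] times a partial sum of
    the [a k], and the latter is at most 1 as the probability of a disjoint union. *)
Lemma poisson_mean_le d (T : measurableType d) (R : realType)
    (P : probability T R) (rate : R) (N : {RV P >-> nat}) :
  0 < rate -> poisson_variable rate N ->
  (\int[P]_t ((N t)%:R)%:E <= rate%:E)%E.
Proof.
move=> r0 NP.
have mfib k : measurable (N @^-1` [set k]).
  by rewrite -[X in measurable X]setTI; apply: measurable_funP.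
have mN : measurable_fun [set: T] (fun t => (N t)%:R : R).
  by apply: (measurable_countable_param (F := fun k (_ : T) => k%:R : R)) => //.
pose a k : R := poisson_pmf rate k.
have a0 k : 0 <= a k := poisson_pmf_ge0 rate k.
have aS k : k.+1%:R * a k.+1 = rate * a k.
  rewrite /a /poisson_pmf r0 factS natrM exprS invfM.
  have k0 : k.+1%:R != 0 :> R by rewrite pnatr_eq0.
  have kf0 : k`!%:R != 0 :> R by rewrite pnatr_eq0 -lt0n fact_gt0.
  move: k0 kf0; move: (k.+1%:R) (k`!%:R) => x y x0 y0.
  by field; rewrite x0 y0.
have sum_a n : \sum_(0 <= k < n) a k <= 1.
  have -> : \sum_(0 <= k < n) a k =
      Rintegral P [set: T] (fun t => \sum_(0 <= k < n) \1_(N @^-1` [set k]) t).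
    rewrite bm_Rintegral_sum//; last first.
      move=> k; split; first exact: measurable_indic.
      by exists 1 => t; rewrite indicE; case: (_ \in _); rewrite ?normr1 ?normr0.
    apply: eq_bigr => k _; apply/EFin_inj; rewrite -NP /Rintegral integral_indic//.
    by rewrite setIT fineK// fin_num_measure.
  rewrite -[leRHS](@probability_Rintegral_cst _ _ _ P).
  apply: bm_le_Rintegral => //; last first.
  - move=> t _; have [tn|tn] := ltnP (N t) n.
      rewrite (bigD1_seq (N t))/= ?iota_uniq ?mem_index_iota//.
      rewrite indicE mem_set// big1 ?addr0// => k kN.
      by rewrite indicE memNset//= => /esym/eqP; rewrite (negbTE kN).
    rewrite big1_seq// => k; rewrite mem_index_iota => /andP[_ /andP[_ kn]].
    rewrite indicE memNset//= => Nk.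
    by move: tn; rewrite Nk leqNgt kn.
  - exact: bm_cst.
  - apply: bm_sum => k; split; first exact: measurable_indic.
    by exists 1 => t; rewrite indicE; case: (_ \in _); rewrite ?normr1 ?normr0.
rewrite (_ : setT = \bigcup_k (N @^-1` [set k])); last first.
  by apply/seteqP; split => // t _; exists (N t).
rewrite ge0_integral_bigcup//; last 2 first.
- by apply/measurable_EFinP; apply: measurable_funTS.
- apply/trivIsetP => i j _ _ ij; apply/seteqP; split => // t [/= Ni Nj].
  by move: ij; rewrite -Ni -Nj eqxx.
have fibE k : (\int[P]_(t in N @^-1` [set k]) ((N t)%:R)%:E = (k%:R * a k)%:E)%E.
  rewrite (eq_integral (fun=> (k%:R)%:E)); last first.
    by move=> t; rewrite inE /= => ->.
  by rewrite integral_cst// EFinM -NP.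
under eq_eseriesr do rewrite fibE.
apply: lime_le.
  by apply: is_cvg_nneseries => k _ _; rewrite lee_fin mulr_ge0.
apply: nearW => n; rewrite sumEFin lee_fin.
case: n => [|n]; first by rewrite big_nil ltW.
rewrite big_nat_recl// mul0r add0r.
under eq_bigr do rewrite aS.
by rewrite -big_distrr/= -[leRHS]mulr1 ler_pM2l.
Qed.

(** * Iteration of the cavity step *)

Section Iteration.
Context d d' (T : measurableType d) (T' : measurableType d') (R : realType).
Variables (P : probability T R) (P' : probability T' R).
Variables (p : nat) (alpha beta : R) (D : disorder P p) (X : thermal P').
Variable sigma : R * R * R * R -> R.
Hypothesis p_gt0 : (0 < p)%N.
Hypothesis alpha_gt0 : 0 < alpha.
Hypothesis beta_gt0 : 0 < beta.
Hypothesis D_law : disorder_law alpha D.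
Hypothesis X_law : thermal_law X.
Hypothesis sign_sigma : sign_function sigma.
Hypothesis cavity : forall n m q r : nat,
  (1 <= n)%N -> (n <= m)%N -> (1 <= q)%N ->
  forall C : 'I_q -> {set 'I_m}, cavity_equation beta D X sigma n r C.

Local Notation tau := (sign_bit sigma).
Local Notation G := (gibbs D X tau).
Local Notation lab2 := (@standard_label 2).

(** The constant [rho]: [expR (- beta)] bounds one interaction factor from below and is squared for
    the two replicas; [alpha * p] is the mean number of interactions of a site. *)
Definition branching : R :=
  (1 - expR (- beta) ^+ 2) * (p.-1%:R * (alpha * p%:R)).

Lemma branching_ge0 : 0 <= branching.
Proof.
have /andP[e0 e1] := expRNbeta01 beta_gt0.
rewrite mulr_ge0 ?mulr_ge0 ?(ltW alpha_gt0)//.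
by rewrite subr_ge0 exprn_ile1// ltW.
Qed.

(** The bound ranges over all families of spins and all pairs of functions, because one step
    replaces the sites by their neighbors and the functions by their lifts. *)
Definition swap_bound (c : R) : Prop :=
  forall m (lab : 'I_m -> seq nat) A f f', injective lab ->
    swap_pair A f f' ->
    Rintegral P [set: T] (fun t => (two_replica f (G lab t) /
      two_replica f' (G lab t)) ^+ 2) <= c * #|A|%:R.

Lemma regular_ratio m (A : {set 'I_m}) f f' : swap_pair A f f' ->
  regular (fun nu : conf m -> R => (two_replica f nu / two_replica f' nu) ^+ 2).
Proof.
move=> [rf rf' _ _ [c c0 cP]].
apply/regularX/regularM; first exact: regular_two_replica.
by apply: (regularV _ c0) => //; exact: regular_two_replica.
Qed.

Lemma swap_pair_set0 m (f f' : conf m -> conf m -> (conf m -> R) -> R) nu :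
  swap_pair finset.set0 f f' -> simplex nu -> two_replica f nu = 0.
Proof.
move=> [_ _ _ anti _] nuS; apply: big1 => s1 _; apply: big1 => s2 _.
have swap0 s s' : swap finset.set0 s s' = s by apply/ffunP => i; rewrite ffunE inE.
have := anti nu s1 s2 nuS; rewrite !swap0 => /eqP.
by rewrite -addr_eq0 -mulr2n mulrn_eq0/= => /eqP ->; rewrite mulr0.
Qed.

Let mtau : measurable_fun [set: R * R * R * R] tau.
Proof. exact: measurable_sign_bit. Qed.

(** Domination bounds the ratio by 1, hence by [#|A|] unless [A] is empty, in which case
    antisymmetry makes the numerator vanish. *)
Lemma swap_bound1 : swap_bound 1.
Proof.
move=> m lab A f f' labI ff'; rewrite mul1r.
have bQ := bm_regular_gibbs D X mtau lab (regular_ratio ff').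
have [A0|/set0Pn[i iA]] := eqVneq A finset.set0.
  rewrite A0 cards0 -[leRHS](@probability_Rintegral_cst _ _ _ P).
  apply: bm_le_Rintegral => //; first exact: bm_cst.
  move=> t _; rewrite A0 in ff'.
  by rewrite (swap_pair_set0 ff') ?mul0r ?expr0n//; exact: gibbs_simplex.
have A1 : 1 <= #|A|%:R :> R by rewrite ler1n card_gt0; apply/set0Pn; exists i.
apply: le_trans A1; rewrite -[leRHS](@probability_Rintegral_cst _ _ _ P).
apply: bm_le_Rintegral => //; first exact: bm_cst.
move=> t _; have gS : simplex (G lab t) by exact: gibbs_simplex.
have [_ _ le _ [c c0 cP]] := ff'.
have D0 : 0 < two_replica f' (G lab t) by rewrite (lt_le_trans c0)// cP.
rewrite -real_normK ?num_real// exprn_ile1// normrM normfV (gtr0_norm D0).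
rewrite ler_pdivrMr// mul1r.
by apply: normr_two_replica => // s1 s2; exact: le.
Qed.

Lemma swap_bound_step c : 0 <= c -> swap_bound c -> swap_bound (c * branching).
Proof.
move=> c0 IH m lab A f f' labI ff'.
have rQ := regular_ratio ff'.
(* Without sites there is no cavity equation, as these require [n >= 1]; then [A] is empty and the
   numerator vanishes. *)
have [m0|m_gt0] := posnP m.
  have A0 : A = finset.set0.
    by apply/setP => i; have := ltn_ord i; rewrite {2}m0.
  rewrite A0 cards0 mulr0 -[leRHS](@probability_Rintegral_cst _ _ _ P).
  apply: bm_le_Rintegral => //; first exact: (bm_regular_gibbs D X mtau lab rQ).
    exact: bm_cst.
  move=> t _; rewrite A0 in ff'.
  by rewrite (swap_pair_set0 ff') ?mul0r ?expr0n//; exact: gibbs_simplex.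
have exch n (l l' : 'I_n -> seq nat) E Phi : environment_event D E ->
    injective l -> injective l' -> regular Phi ->
    Rintegral P E (fun t => Phi (G l t)) =
    fine (P E) * Rintegral P [set: T] (fun t => Phi (G l' t)).
  move=> envE lI l'I rPhi; apply: gibbs_exchange => //.
  - exact: law_v D_law.
  - exact: law_w D_law.
  - exact: disorder_indep D_law.
have stdI : injective (@standard_label m) by move=> i j [/val_inj].
pose Q (nu : conf m -> R) := (two_replica f nu / two_replica f' nu) ^+ 2.
(* The labels are made standard by exchangeability, after which the spins can be replaced by the new
   ones. *)
have -> : Rintegral P [set: T] (fun t => Q (G lab t)) =
    Rintegral P [set: T] (fun t => Q (new_gibbs beta D X sigma (m := m) t)).
  rewrite -(cavity_regular beta_gt0 D_law X_law sign_sigma cavity m_gt0 rQ).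
  rewrite (exch _ _ _ _ _ (environment_eventT D) labI stdI rQ).
  by rewrite probability_setT mul1r.
pose Z t := Q (new_gibbs beta D X sigma (m := m) t).
have Z0 t : 0 <= Z t by exact: sqr_ge0.
have bZ : bounded_measurable Z.
  apply: bm_regular => //.
  - move=> t; exact: (new_gibbs_simplex beta_gt0 D_law X_law sign_sigma).
  - move=> s; exact: (measurable_new_gibbs beta_gt0 D_law X_law sign_sigma).
pose c1 := c * ((1 - expR (- beta) ^+ 2) * p.-1%:R).
have c10 : 0 <= c1.
  have /andP[e0 e1] := expRNbeta01 beta_gt0.
  by rewrite !mulr_ge0// subr_ge0 exprn_ile1// ltW.
(* The bound for given numbers of interactions; averaging these by the Poisson law turns [h] into
   [c * branching * #|A|]. *)
pose h t : R := c1 * \sum_(i in A) (dis_pi D i t)%:R.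
have h0 t : 0 <= h t by rewrite mulr_ge0// sumr_ge0.
have mpi i : measurable_fun [set: T] (fun t => (dis_pi D i t)%:R : R).
  apply: (measurable_countable_param (F := fun k (_ : T) => k%:R : R)) => //.
  by move=> k; rewrite -[X in measurable X]setTI; apply: measurable_funP.
have mh : measurable_fun [set: T] h.
  apply: measurable_funM => //; under eq_fun do rewrite big_mkcond/=.
  by apply: measurable_sum => i; case: (i \in A).
have mZE : measurable_fun [set: T] (EFin \o Z).
  by apply/measurable_EFinP; case: bZ.
have mhE : measurable_fun [set: T] (EFin \o h) by exact/measurable_EFinP.
(* On this event the new law is [cavity_map], with fixed weights, at the Gibbs law of the neighbors,
   and conditioning does not change the distribution of the latter. *)
have key (kappa : {ffun 'I_m -> nat}) (b : environment p m (max_degree kappa)) :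
    let E := degrees D m @^-1` [set kappa] `&`
             environment_at D m (max_degree kappa) @^-1` [set b] in
    (\int[P]_(t in E) (Z t)%:E <= \int[P]_(t in E) (h t)%:E)%E.
  move=> E; have envE : environment_event D E by exact: environment_event_fiber.
  have mE : measurable E by exact: measurable_environment_event envE.
  pose nl := @neighbor_label p m (max_degree kappa).
  have nlI : injective nl by exact: neighbor_label_inj.
  pose Phi nu := Q (cavity_map kappa (interaction beta b) nu).
  have rPhi : regular Phi.
    apply: (regular_comp rQ (regular_cavity_map _ (expRNbeta01 beta_gt0)
      (interactionP beta_gt0 _))).
    exact: (cavity_map_simplex _ (expRNbeta01 beta_gt0) (interactionP beta_gt0 _)).
  have bound : Rintegral P [set: T] (fun t => Phi (G nl t)) <=
      c1 * \sum_(i in A) (kappa i)%:R.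
    pose Ex (Psi : (conf #|{: neighbor m (max_degree kappa) p}| -> R) -> R) :=
      Rintegral P [set: T] (fun t => Psi (G nl t)).
    have bG Psi : regular Psi -> bounded_measurable (fun t => Psi (G nl t)).
      by move=> rPsi; exact: bm_regular_gibbs.
    have Ex_le Phi1 Phi2 : regular Phi1 -> regular Phi2 ->
        (forall nu, simplex nu -> Phi1 nu <= Phi2 nu) -> Ex Phi1 <= Ex Phi2.
      move=> r1 r2 le12; apply: bm_le_Rintegral => //; [exact: bG|exact: bG|].
      by move=> t _; apply: le12; exact: gibbs_simplex.
    have Ex_lin (a1 a2 : R) Phi1 Phi2 : regular Phi1 -> regular Phi2 ->
        Ex (fun nu => a1 * Phi1 nu + a2 * Phi2 nu) = a1 * Ex Phi1 + a2 * Ex Phi2.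
      by move=> r1 r2; apply: bm_Rintegral_lin => //; exact: bG.
    have Ex_swap A' g g' : swap_pair A' g g' ->
        Ex (fun nu => (two_replica g nu / two_replica g' nu) ^+ 2) <= c * #|A'|%:R.
      by move=> gg'; exact: IH.
    have := cavity_step kappa (expRNbeta01 beta_gt0) (interactionP beta_gt0 b)
      (@interaction_local _ p beta m (max_degree kappa) b) Ex_le Ex_lin c0 Ex_swap ff'.
    by move=> /le_trans; apply; rewrite /c1 le_eqVlt; apply/orP; left; apply/eqP; ring.
  have -> : (\int[P]_(t in E) (Z t)%:E = \int[P]_(t in E) (Phi (G nl t))%:E)%E.
    apply: eq_integral => t; rewrite inE => -[/= dk eb].
    by rewrite /Z (new_gibbsE _ D_law X_law sign_sigma dk) eb.
  rewrite -(bm_EFin_Rintegral P mE (bm_regular_gibbs D X mtau nl rPhi)).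
  rewrite (exch _ _ _ _ _ envE nlI nlI rPhi).
  rewrite (eq_integral (fun=> (c1 * \sum_(i in A) (kappa i)%:R)%:E)); last first.
    move=> t; rewrite inE => -[/= dk _].
    by congr (_ * _)%:E; apply: eq_bigr => i _; rewrite -dk ffunE.
  rewrite integral_cst// -[X in (_ * X)%E]fineK ?fin_num_measure//.
  by rewrite -EFinM lee_fin mulrC ler_wpM2r ?fine_ge0.
have : (\int[P]_t (Z t)%:E <= \int[P]_t (h t)%:E)%E.
  apply: (@le_integral_fibers _ _ _ P _ (degrees D m) setT
    (EFin \o Z) (EFin \o h) measurableT).
  - by move=> kappa; rewrite setTI; exact: measurable_degrees.
  - exact: mZE.
  - exact: mhE.
  - by [].
  - by [].
  (* Which signs have to be fixed depends on [max_degree kappa], so the degrees are fixed first and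
     the signs inside each fiber. *)
  - move=> kappa; rewrite setTI.
    apply: (@le_integral_fibers _ _ _ P _ (environment_at D m (max_degree kappa))
      _ (EFin \o Z) (EFin \o h) (measurable_degrees D kappa)).
    + move=> b; apply: measurableI; first exact: measurable_degrees.
      exact: measurable_environment_at.
    + exact: measurable_funTS.
    + exact: measurable_funTS.
    + by [].
    + by [].
    + by move=> b; exact: key.
rewrite -(bm_EFin_Rintegral P measurableT bZ) => ZH; rewrite -lee_fin.
apply: (le_trans ZH).
rewrite /h; under eq_integral do rewrite EFinM.
rewrite ge0_integralZl//; last 2 first.
- apply/measurable_EFinP; under eq_fun do rewrite big_mkcond/=.
  by apply: measurable_sum => i; case: (i \in A).
- by move=> t _; rewrite lee_fin sumr_ge0.
under eq_integral do rewrite -sumEFin -big_enum/=.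
rewrite ge0_integral_sum//; last by move=> i; exact/measurable_EFinP.
rewrite big_enum/=.
apply: (@le_trans _ _ (c1%:E * (\sum_(i in A) (alpha * p%:R)%:E))%E).
  rewrite lee_wpmul2l ?lee_fin//; apply: lee_sum => i _.
  apply: poisson_mean_le; last exact: law_pi D_law i.
  by rewrite mulr_gt0// ltr0n.
rewrite sumEFin -EFinM lee_fin sumr_const -mulr_natr /c1 /branching.
by rewrite le_eqVlt; apply/orP; left; apply/eqP; ring.
Qed.

Lemma swap_bound_iter k : swap_bound (branching ^+ k).
Proof.
elim: k => [|k IH]; first by rewrite expr0; exact: swap_bound1.
by rewrite exprSr; apply: swap_bound_step => //; rewrite exprn_ge0 ?branching_ge0.
Qed.

Hypothesis branching_lt1 : branching < 1.

Lemma swap_decorrelation m (lab : 'I_m -> seq nat) A f f' : injective lab ->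
  swap_pair A f f' ->
  Rintegral P [set: T] (fun t => (two_replica f (G lab t) /
    two_replica f' (G lab t)) ^+ 2) <= 0.
Proof.
move=> labI ff'.
have q1 : `|branching| < 1 by rewrite ger0_norm ?branching_ge0.
apply/ler_addgt0Pl => e e0; rewrite addr0.
(* Adding 1 keeps the divisor positive when [A] is empty. *)
have a0 : 0 < #|A|%:R + 1 :> R by rewrite ltr_wpDl.
have /cvgrPdist_le/(_ (e / (#|A|%:R + 1)))[|N _ /(_ N (leqnn _))/=] := cvg_expr q1.
  exact: divr_gt0.
rewrite sub0r normrN ger0_norm ?exprn_ge0 ?branching_ge0// => qN.
apply: (le_trans (swap_bound_iter N labI ff')).
apply: (@le_trans _ _ (e / (#|A|%:R + 1) * #|A|%:R)); first by rewrite ler_wpM2r.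
by rewrite mulrAC ler_pdivrMr// ler_wpM2l ?lerDl// ltW.
Qed.

Definition covariance_at (t : T) : R :=
  E' P' (fun t' => spin D X sigma [:: 0%N] t t' * spin D X sigma [:: 1%N] t t') -
  E' P' (fun t' => spin D X sigma [:: 0%N] t t') *
  E' P' (fun t' => spin D X sigma [:: 1%N] t t').

(** Exchanging the replicas at site 0 alone reverses the first difference and leaves the second.
    Each difference is at most 2 in absolute value, whence [f' = 4]; the average of [f] is twice the
    covariance. *)
Lemma covariance_at_eq0 : Rintegral P [set: T] (fun t => covariance_at t ^+ 2) <= 0.
Proof.
pose sg (s : conf 2) i : R := (-1) ^+ s i.
pose i0 : 'I_2 := ord0. pose i1 : 'I_2 := ord_max.
pose f (s1 s2 : conf 2) (nu : conf 2 -> R) : R :=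
  (sg s1 i0 - sg s2 i0) * (sg s1 i1 - sg s2 i1).
pose f' (s1 s2 : conf 2) (nu : conf 2 -> R) : R := 4.
have f'E nu : simplex nu -> two_replica f' nu = 4.
  move=> [_ nu1]; rewrite /two_replica /f'.
  under eq_bigr do rewrite -mulr_suml -mulr_sumr nu1 mulr1.
  by rewrite -mulr_suml nu1 mul1r.
have ff' : swap_pair [set i0]%SET f f'.
  split.
  - by move=> *; exact: regular_cst.
  - by move=> *; exact: regular_cst.
  - move=> nu s1 s2 _; rewrite normrM (_ : f' s1 s2 nu = 2 * 2); last by rewrite /f'; ring.
    have n2 i : `|sg s1 i - sg s2 i| <= 2.
      rewrite (le_trans (ler_normB _ _))// /sg !normrX !normrN1 !expr1n.
      by lra.
    by rewrite ler_pM.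
  - move=> nu s1 s2 _; rewrite /f /sg !ffunE !inE eqxx.
    by rewrite (_ : (i1 == i0) = false)//; ring.
  - by exists 4 => // nu nuS; rewrite f'E.
have labI : injective lab2 by move=> i j [/val_inj].
have covE t : two_replica f (G lab2 t) / two_replica f' (G lab2 t) =
    covariance_at t / 2.
  have gS : simplex (G lab2 t) by exact: gibbs_simplex.
  rewrite f'E//.
  have mom F : \sum_s G lab2 t s * F s = Rintegral P' [set: T']
      (fun t' => F (spin_conf D X tau lab2 t t')).
    by rewrite (gibbs_expectation D X mtau).
  have s0 t' : sg (spin_conf D X tau lab2 t t') i0 = spin D X sigma [:: 0%N] t t'.
    by rewrite (spinE D_law X_law sign_sigma) /sg ffunE.
  have s1 t' : sg (spin_conf D X tau lab2 t t') i1 = spin D X sigma [:: 1%N] t t'.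
    by rewrite (spinE D_law X_law sign_sigma) /sg ffunE.
  have -> : covariance_at t =
    \sum_s G lab2 t s * (sg s i0 * sg s i1) -
    (\sum_s G lab2 t s * sg s i0) * (\sum_s G lab2 t s * sg s i1).
    rewrite !mom /covariance_at /E'; congr (_ - _ * _);
    by apply: eq_Rintegral => t' _; rewrite ?s0 ?s1.
  have [_ nu1] := gS; move: nu1; set nu := G lab2 t => nu1.
  rewrite /two_replica /f.
  have -> : \sum_s1 \sum_s2 nu s1 * nu s2 *
      ((sg s1 i0 - sg s2 i0) * (sg s1 i1 - sg s2 i1)) =
    \sum_s1 (nu s1 * (sg s1 i0 * sg s1 i1) +
      nu s1 * (\sum_s2 nu s2 * (sg s2 i0 * sg s2 i1)) -
      nu s1 * sg s1 i0 * (\sum_s2 nu s2 * sg s2 i1) -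
      nu s1 * sg s1 i1 * (\sum_s2 nu s2 * sg s2 i0)).
    apply: eq_bigr => a _; rewrite -[X in X + _ - _ - _](mulr1) -nu1.
    rewrite !big_distrr/= -big_split/= -!sumrB; apply: eq_bigr => b _; ring.
  rewrite !sumrB big_split/= -!mulr_suml nu1.
  have half (e x y : R) : (e + 1 * e - x * y - y * x) / 4 = (e - x * y) / 2 by field.
  exact: half.
have bQ := bm_regular_gibbs D X mtau lab2 (regular_ratio ff').
have -> : Rintegral P [set: T] (fun t => covariance_at t ^+ 2) =
    4 * Rintegral P [set: T] (fun t =>
      (two_replica f (G lab2 t) / two_replica f' (G lab2 t)) ^+ 2).
  by rewrite -bm_RintegralZl//; apply: eq_Rintegral => t _; rewrite covE; field.
rewrite pmulr_rle0//; exact: (swap_decorrelation labI ff').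
Qed.

End Iteration.

(** * From vanishing covariances to the conclusion *)

Lemma bm_prod_Rintegral d d' (T : measurableType d) (T' : measurableType d')
    (R : realType) (P : probability T R) (P' : probability T' R)
    (f : T * T' -> R) : bounded_measurable f ->
  Rintegral (P \x P')%E [set: T * T'] f =
  Rintegral P [set: T] (fun x => Rintegral P' [set: T'] (fun y => f (x, y))).
Proof.
move=> bf; have bx x : bounded_measurable (fun y => f (x, y)).
  by apply: (@bm_comp _ _ _ _ _ f (pair x)) => //; exact: measurable_pair1.
have fi : (P \x P')%E.-integrable setT (EFin \o f).
  exact: (@bm_integrable _ _ _ (P \x P')%E).
have := integral12_prod_meas1 fi; rewrite /Rintegral => <-; congr fine.
by apply: eq_integral => x _; rewrite bm_EFin_Rintegral.
Qed.

Lemma L2_null_orthogonal d (T : measurableType d) (R : realType)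
    (P : probability T R) (K phi : T -> R) :
  bounded_measurable K -> bounded_measurable phi ->
  Rintegral P [set: T] (fun t => K t ^+ 2) <= 0 ->
  Rintegral P [set: T] (fun t => K t * phi t) = 0.
Proof.
move=> bK bphi K0.
have bK2 : bounded_measurable (fun t => K t ^+ 2) by exact: bmM.
have bp2 : bounded_measurable (fun t => phi t ^+ 2) by exact: bmM.
have bKp : bounded_measurable (fun t => K t * phi t) by exact: bmM.
set I := Rintegral _ _ _; set A := Rintegral P [set: T] (fun t => phi t ^+ 2).
(* [0 <= int (phi + c K)^2 = int phi^2 + 2 c int (K phi)] for every [c]. *)
have H c : 0 <= A + 2 * c * I.
  have : 0 <= Rintegral P [set: T] (fun t => (phi t + c * K t) ^+ 2).
    by apply: Rintegral_ge0 => t _; exact: sqr_ge0.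
  have -> : Rintegral P [set: T] (fun t => (phi t + c * K t) ^+ 2) =
      1 * A + 1 * (2 * c * I + c ^+ 2 * Rintegral P [set: T] (fun t => K t ^+ 2)).
    rewrite -bm_Rintegral_lin// -bm_Rintegral_lin//; last first.
      by apply: bmD; apply: bmM => //; exact: bm_cst.
    by apply: eq_Rintegral => t _; ring.
  rewrite !mul1r addrA => /le_trans; apply.
  by rewrite gerDl mulr_ge0_le0// sqr_ge0.
(* If [I] were nonzero, this value of [c] would bring the right-hand side of [H] down to -1. *)
apply/eqP; apply: contraT => I0; have := H (- (A + 1) / (2 * I)).
rewrite (_ : A + _ = -1); first by rewrite lerNr oppr0 ler10.
by field.
Qed.

(** * Functions determined by their integrals over a pi-system *)

Section DensityMeasure.
Context d (T : measurableType d) (R : realType) (P : probability T R).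

Definition density_measure (f : T -> R) (mf : measurable_fun [set: T] f)
    (f0 : forall x, 0 <= f x) (A : set T) : \bar R := (\int[P]_(x in A) (f x)%:E)%E.

Section Instance.
Variables (f : T -> R) (mf : measurable_fun [set: T] f) (f0 : forall x, 0 <= f x).
Local Notation nu := (density_measure mf f0).

Let nu0 : nu set0 = 0%E. Proof. exact: integral_set0. Qed.

Let nu_ge0 A : (0 <= nu A)%E.
Proof. by apply: integral_ge0 => x _; rewrite lee_fin. Qed.

Let nu_sigma : semi_sigma_additive nu.
Proof.
by apply: semi_sigma_additive_nng_induced => [|x]; [exact/measurable_EFinP|rewrite lee_fin].
Qed.

HB.instance Definition _ := isMeasure.Build _ _ _ nu nu0 nu_ge0 nu_sigma.
End Instance.

(** Shifted by a constant, [f] and [g] are densities of finite measures that agree on a generating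
    pi-system, hence on all measurable sets. *)
Lemma eq_density (f g : T -> R) (C : set (set T)) :
  bounded_measurable f -> bounded_measurable g ->
  measurable = <<s C >> -> setI_closed C -> C [set: T] ->
  (forall A, C A -> Rintegral P A f = Rintegral P A g) ->
  P [set x | f x != g x] = 0%E.
Proof.
move=> bf bg mC CI CT fg; have [mf [M fM]] := bf; have [mg [N gN]] := bg.
have Cm A : C A -> measurable A by rewrite mC; exact: sub_sigma_algebra.
pose L := `|M| + `|N|.
have f0 x : 0 <= f x + L.
  have := fM x; have := ler_norm M; have := normr_ge0 N.
  by rewrite ler_norml /L => ? ? /andP[? _]; lra.
have g0 x : 0 <= g x + L.
  have := gN x; have := ler_norm N; have := normr_ge0 M.
  by rewrite ler_norml /L => ? ? /andP[? _]; lra.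
have bfL : bounded_measurable (fun x => f x + L) by apply: bmD => //; exact: bm_cst.
have bgL : bounded_measurable (fun x => g x + L) by apply: bmD => //; exact: bm_cst.
have eqA A : measurable A -> density_measure bfL.1 f0 A = density_measure bgL.1 g0 A.
  move=> mA; apply: (measure_unique C (fun=> setT)) => //.
  - by apply/seteqP; split => // x _; exists 0%N.
  - move=> B CB; have mB := Cm _ CB; rewrite /= /density_measure.
    rewrite -!bm_EFin_Rintegral//; congr (_%:E).
    have split_cst h : bounded_measurable h -> Rintegral P B (fun x => h x + L) =
        Rintegral P B h + Rintegral P B (fun=> L).
      move=> bh; rewrite RintegralD//; first exact: bm_integrable.
      by apply: bm_integrable => //; exact: bm_cst.
    by rewrite !split_cst// fg.
  - by move=> _; rewrite /= /density_measure -bm_EFin_Rintegral// ltry.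
have : ae_eq P [set: T] (fun x => (f x + L)%:E) (fun x => (g x + L)%:E).
  apply: integral_ae_eq => //.
  - exact: bm_integrable.
  - by apply/measurable_EFinP; exact: bgL.1.
  - by move=> A _ mA; exact: eqA.
move=> [Z [mZ Z0 sub]]; apply: (subset_measure0 _ mZ _ Z0).
  rewrite (_ : [set x | _] = (fun x => f x == g x) @^-1` [set false]).
    by rewrite -[X in measurable X]setTI; apply: measurable_fun_eqr.
  by apply/seteqP; split => x /=; [move=> /negbTE|move=> /negbT].
move=> x /= fx; apply: sub => /= H; move/eqP: fx; apply.
by have [] := H Logic.I; move/addIr.
Qed.

End DensityMeasure.

(** * Uniform and Lebesgue measures on the unit cube *)

Section UniformCube.
Context (R : realType).

(* [lebesgue_measure] lives on this copy of [R], which has the Borel sets of [R]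
   but a different display. *)
Local Notation RR := (measurableTypeR R).

Definition unif : probability RR R := uniform_prob (@ltr01 R).

Definition unif3 : probability (RR * RR * RR)%type R := ((unif \x unif) \x unif)%E.

Lemma measurable_idR : measurable_fun [set: RR] (fun x => x : R).
Proof. by move=> _ A mA; rewrite setTI. Qed.

Lemma unifE (A : set RR) : measurable A ->
  unif A = lebesgue_measure (A `&` `[0, 1]%classic).
Proof.
move=> mA; rewrite /unif/= /uniform_prob integral_uniform_pdf.
rewrite (eq_integral (fun=> 1%E)); last first.
  move=> x; rewrite inE/= in_itv/= => -[_ x01].
  by rewrite /uniform_pdf x01 subr0 invr1.
by rewrite integral_cst ?mul1e//; exact: measurableI.
Qed.

Lemma unif_Rintegral (f : RR -> R) : bounded_measurable f ->
  Rintegral unif [set: RR] f = Rintegral lebesgue_measure `[0, 1]%classic f.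
Proof.
move=> bf; have [mf [M fM]] := bf.
have m01 : measurable (`[0, 1]%classic : set RR) by [].
have L01 : lebesgue_measure (`[0, 1]%classic : set RR) = 1%E.
  by rewrite lebesgue_measure_itv/= lte_fin ltr01 oppr0 adde0.
have li g : bounded_measurable g ->
    lebesgue_measure.-integrable (`[0, 1]%classic : set RR) (EFin \o g).
  move=> [mg [N gN]]; apply: measurable_bounded_integrable => //.
  - exact: (eq_ind_r (fun z => (z < +oo)%E) (ltry (1 : R)) L01).
  - exact: measurable_funTS.
  - exists N; split; first exact: num_real.
    by move=> x Mx t _ /=; rewrite (le_trans (gN t))// ltW.
have bfM : bounded_measurable (fun x => f x + M) by apply: bmD => //; exact: bm_cst.
have H : Rintegral unif [set: RR] (fun x => f x + M) =
    Rintegral lebesgue_measure `[0, 1]%classic (fun x => f x + M).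
  rewrite /Rintegral integral_uniform.
  - by rewrite subr0 invr1 mul1e.
  - by apply/measurable_EFinP; case: bfM.
  - move=> x; rewrite lee_fin -lerBlDr sub0r.
    by have := fM x; rewrite ler_norml => /andP[].
move: H; rewrite RintegralD//; [|exact: bm_integrable|exact/bm_integrable/bm_cst].
rewrite RintegralD//; [|exact: li|exact/li/bm_cst].
rewrite probability_Rintegral_cst Rintegral_cst//.
rewrite [X in fine X](_ : _ = 1%E) ?mulr1; last exact: L01.
by move/addIr.
Qed.

(** A product measure is determined by its values on rectangles, where restriction acts on each side
    separately. This later turns null sets of the uniform law into Lebesgue null sets. *)
Lemma prod_restrict d d' (T : measurableType d) (T' : measurableType d')
    (m : {measure set T -> \bar R})
    (m' : {sigma_finite_measure set T' -> \bar R})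
    (P : probability T R) (P' : probability T' R) (D : set T) (D' : set T')
    (A : set (T * T')) :
  measurable D -> measurable D' ->
  (forall B, measurable B -> P B = m (B `&` D)) ->
  (forall B, measurable B -> P' B = m' (B `&` D')) ->
  measurable A ->
  (P \x P')%E A = (m \x m')%E (A `&` (D `*` D')).
Proof.
move=> mD mD' PE P'E mA.
have mDD : measurable (D `*` D') by exact: measurableX.
apply: (@product_measure_unique _ _ _ _ _ _ _ (mrestr (m \x m')%E mDD)) => //.
move=> B B' mB mB'; rewrite /= /mrestr -setXI.
by rewrite product_measure1E ?PE ?P'E//; exact: measurableI.
Qed.

Lemma prod_restrict3 d1 d2 d3 (T1 : measurableType d1) (T2 : measurableType d2)
    (T3 : measurableType d3)
    (m1 : {measure set T1 -> \bar R})
    (m2 : {sigma_finite_measure set T2 -> \bar R})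
    (m3 : {sigma_finite_measure set T3 -> \bar R})
    (P1 : probability T1 R) (P2 : probability T2 R) (P3 : probability T3 R)
    (D1 : set T1) (D2 : set T2) (D3 : set T3) (A : set (T1 * T2 * T3)) :
  measurable D1 -> measurable D2 -> measurable D3 ->
  (forall B, measurable B -> P1 B = m1 (B `&` D1)) ->
  (forall B, measurable B -> P2 B = m2 (B `&` D2)) ->
  (forall B, measurable B -> P3 B = m3 (B `&` D3)) ->
  measurable A ->
  ((P1 \x P2) \x P3)%E A = ((m1 \x m2) \x m3)%E (A `&` (D1 `*` D2 `*` D3)).
Proof.
move=> mD1 mD2 mD3 E1 E2 E3 mA; apply: prod_restrict => //.
  exact: measurableX.
by move=> B mB; exact: prod_restrict.
Qed.

Lemma tuple3_rectangle (B : 'I_3 -> set R) :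
  (fun y : RR * RR * RR => [tuple y.1.1 : R; y.1.2 : R; y.2 : R]) @^-1`
    [set u : 3.-tuple R | forall k, B k (tnth u k)] =
  (B (@Ordinal 3 0 isT) `*` B (@Ordinal 3 1 isT)) `*` B (@Ordinal 3 2 isT).
Proof.
apply/seteqP; split => [[[w u] v]|[[w u] v]] /=.
  move=> H; split; last exact: (H (@Ordinal 3 2 isT)).
  by split; [exact: (H (@Ordinal 3 0 isT))|exact: (H (@Ordinal 3 1 isT))].
move=> [[h0 h1] h2] [[|[|[|k]]] lt3] //=.
- by rewrite (_ : Ordinal lt3 = @Ordinal 3 0 isT)//; exact: val_inj.
- by rewrite (_ : Ordinal lt3 = @Ordinal 3 1 isT)//; exact: val_inj.
- by rewrite (_ : Ordinal lt3 = @Ordinal 3 2 isT)//; exact: val_inj.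
Qed.

Lemma measurable_tuple3 :
  measurable_fun [set: RR * RR * RR] (fun y => [tuple y.1.1 : R; y.1.2 : R; y.2 : R]).
Proof.
apply/measurable_fun_tnthP => -[[|[|[|k]]] lt3] //.
- exact: (measurableT_comp measurable_idR
    (measurableT_comp measurable_fst measurable_fst)).
- exact: (measurableT_comp measurable_idR
    (measurableT_comp measurable_snd measurable_fst)).
- exact: (measurableT_comp measurable_idR measurable_snd).
Qed.

(** This links the tuples in which the random variables are collected with the product measure to
    which Fubini's theorem applies. *)
Lemma uniform3_law d (T : measurableType d) (P : probability T R)
    (Y : T -> 3.-tuple R) (F : 3.-tuple R -> R) :
  measurable_fun [set: T] Y ->
  (forall B : 'I_3 -> set R, (forall k, measurable (B k)) ->
     P (Y @^-1` [set u | forall k, B k (tnth u k)]) =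
     (\prod_k fine (uniform_prob (@ltr01 R) (B k)))%:E) ->
  bounded_measurable F ->
  Rintegral P [set: T] (fun t => F (Y t)) =
  Rintegral unif3 [set: RR * RR * RR] (fun y => F [tuple y.1.1 : R; y.1.2 : R; y.2 : R]).
Proof.
move=> mY YP bF; rewrite -[RHS]mul1r.
apply: (@eq_law_Rintegral _ _ _ _ _ _ _ P unif3 Y
  (fun y => [tuple y.1.1 : R; y.1.2 : R; y.2 : R]) _ _ setT 1 (@rectangles R 3)) => //.
- exact: measurable_tuple3.
- exact: measurable_rectangles.
- exact: setI_closed_rectangles.
- exact: rectanglesT.
- move=> _ [B mB ->]; rewrite setTI mul1e YP// tuple3_rectangle.
  rewrite /unif3/= product_measure1E; [|exact: (measurableX (mB _) (mB _))|exact: mB].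
  rewrite [X in (X * _)%E]product_measure1E; [|exact: mB|exact: mB].
  rewrite !big_ord_recl big_ord0 mulr1 mulrA !EFinM.
  have fk k : (fine (uniform_prob (@ltr01 R) (B k)))%:E = unif (B k).
    by rewrite fineK//; exact: (fin_num_measure unif _ (mB k)).
  rewrite !fk; congr (_ * _ * _)%E; congr (unif (B _)); exact: val_inj.
Qed.

Lemma unif3_Rintegral (f : RR * RR * RR -> R) : bounded_measurable f ->
  Rintegral unif3 [set: RR * RR * RR] f =
  Rintegral unif [set: RR] (fun w => Rintegral unif [set: RR] (fun u =>
    Rintegral unif [set: RR] (fun v => f (w, u, v)))).
Proof.
move=> bf; rewrite bm_prod_Rintegral// bm_prod_Rintegral//.
exact: (bm_fubini unif bf).
Qed.

Lemma negligible_cube (N : set (RR * RR * RR)) : measurable N -> unif3 N = 0%E ->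
  ((lebesgue_measure \x lebesgue_measure) \x lebesgue_measure)%E.-negligible
    (N `&` [set y | [/\ 0 <= y.1.1 <= 1, 0 <= y.1.2 <= 1 & 0 <= y.2 <= 1]]).
Proof.
move=> mN N0; have m01 : measurable (`[0, 1]%classic : set RR) by [].
have uE (B : set RR) : measurable B -> unif B = lebesgue_measure (B `&` `[0, 1]%classic).
  exact: unifE.
have := @prod_restrict3 _ _ _ RR RR RR lebesgue_measure lebesgue_measure
  lebesgue_measure unif unif unif _ _ _ N m01 m01 m01 uE uE uE mN.
rewrite -/unif3 N0 => /esym L0.
exists (N `&` (`[0, 1]%classic `*` `[0, 1]%classic `*` `[0, 1]%classic)); split => //.
  by apply: measurableI => //; apply: measurableX => //; exact: measurableX.
by move=> [[w u] v] /= [Ny [w01 u01 v01]]; split.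
Qed.

End UniformCube.

Ltac measurable_coords :=
  first [ exact: measurable_fst | exact: measurable_snd | exact: measurable_id
        | (apply: measurable_fun_pair; measurable_coords)
        | (apply: (measurableT_comp measurable_fst); measurable_coords)
        | (apply: (measurableT_comp measurable_snd); measurable_coords) ].

(** * Functions whose covariance kernel in [u] is null *)

Section Decorrelation.
Context (R : realType).
Local Notation RR := (measurableTypeR R).
Local Notation "'\int' f" := (Rintegral (unif R) [set: RR] f) (at level 36).

Variable B : RR * RR * RR -> R.
Hypothesis bB : bounded_measurable B.

Definition mean_u (w v : RR) : R := \int (fun u => B (w, u, v)).

Definition centered (y : RR * RR * RR) : R := B y - mean_u y.1.1 y.2.

(** The covariance in [u] at two values of [v]: here [y] is [(w, v, v')], whereas [B] takes
    [(w, u, v)]. *)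
Definition kernel (y : RR * RR * RR) : R :=
  \int (fun u => B (y.1.1, u, y.1.2) * B (y.1.1, u, y.2)) -
  mean_u y.1.1 y.1.2 * mean_u y.1.1 y.2.

Let bmc d (T : measurableType d) (f : RR * RR * RR -> R) (g : T -> RR * RR * RR) :
  bounded_measurable f -> measurable_fun [set: T] g ->
  bounded_measurable (fun t => f (g t)).
Proof. by move=> bf mg; exact: (bm_comp bf mg). Qed.

Lemma bm_mean_u : bounded_measurable (fun z : RR * RR => mean_u z.1 z.2).
Proof.
apply: (bm_fubini (unif R) (f := fun z : RR * RR * RR => B (z.1.1, z.2, z.1.2))).
by apply: bmc => //; measurable_coords.
Qed.

Lemma bm_centered : bounded_measurable centered.
Proof.
apply: bmB => //.
apply: (bm_comp (g := fun y : RR * RR * RR => (y.1.1, y.2)) bm_mean_u).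
by measurable_coords.
Qed.

Lemma bm_kernel : bounded_measurable kernel.
Proof.
apply: bmB.
  apply: (bm_fubini (unif R) (f := fun z : RR * RR * RR * RR =>
    B (z.1.1.1, z.2, z.1.1.2) * B (z.1.1.1, z.2, z.1.2))).
  by apply: bmM; apply: bmc => //; measurable_coords.
apply: bmM.
  apply: (bm_comp (g := fun y : RR * RR * RR => (y.1.1, y.1.2)) bm_mean_u).
  by measurable_coords.
apply: (bm_comp (g := fun y : RR * RR * RR => (y.1.1, y.2)) bm_mean_u).
by measurable_coords.
Qed.

Lemma kernelE w v v' : kernel (w, v, v') =
  \int (fun u => centered (w, u, v) * centered (w, u, v')).
Proof.
have b x : bounded_measurable (fun u : RR => B (w, u, x)).
  by apply: bmc => //; do 2 apply: measurable_fun_pair => //.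
have bb : bounded_measurable (fun u : RR => B (w, u, v) * B (w, u, v')).
  exact: bmM.
rewrite /kernel /centered/=.
transitivity (\int (fun u => 1 * (B (w, u, v) * B (w, u, v')) + 1 *
   ((- mean_u w v') * B (w, u, v) + 1 * ((- mean_u w v) * B (w, u, v') +
    (mean_u w v * mean_u w v') * 1)))); last first.
  by apply: eq_Rintegral => u _; ring.
have bc (c : R) : bounded_measurable (fun _ : RR => c) by exact: bm_cst.
have b1 : bounded_measurable (fun u : RR => (- mean_u w v) * B (w, u, v') +
    (mean_u w v * mean_u w v') * 1) by apply: bmD => //; apply: bmM.
have b2 : bounded_measurable (fun u : RR => (- mean_u w v') * B (w, u, v) + 1 *
  ((- mean_u w v) * B (w, u, v') + (mean_u w v * mean_u w v') * 1)).
  by apply: bmD => //; apply: bmM.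
do 3 (rewrite bm_Rintegral_lin//); rewrite probability_Rintegral_cst.
by rewrite -/(mean_u w v) -/(mean_u w v'); ring.
Qed.

Hypothesis kernel0 :
  Rintegral (unif3 R) [set: RR * RR * RR] (fun y => kernel y ^+ 2) <= 0.

(** Integrating over [v] in [V] first gives a function [Z] of [(w, u)]. Its squared integral is that
    of the null function [kernel] against an indicator, so [Z] is null and thus orthogonal to the
    indicator of [W] times [U]. *)
Lemma box_centered (W U V : set RR) : measurable W -> measurable U -> measurable V ->
  Rintegral (unif3 R) [set: RR * RR * RR]
    (fun y => centered y * (\1_W y.1.1 * \1_U y.1.2 * \1_V y.2)) = 0.
Proof.
move=> mW mU mV.
have bI (A : set RR) : measurable A -> bounded_measurable (\1_A : RR -> R).
  move=> mA; split; first exact: measurable_indic.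
  by exists 1 => x; rewrite indicE; case: (_ \in _); rewrite ?normr1 ?normr0.
have bIc d (T : measurableType d) (A : set RR) (g : T -> RR) : measurable A ->
    measurable_fun [set: T] g -> bounded_measurable (fun t => \1_A (g t) : R).
  by move=> mA mg; exact: (bm_comp (bI A mA) mg).
pose Z (w u : RR) := \int (fun v => centered (w, u, v) * \1_V v).
have bZ : bounded_measurable (fun z : RR * RR => Z z.1 z.2).
  apply: (bm_fubini (unif R) (f := fun z : RR * RR * RR =>
    centered (z.1.1, z.1.2, z.2) * \1_V z.2)).
  apply: bmM; last by apply: bIc => //; measurable_coords.
  by apply: bmc; [exact: bm_centered|measurable_coords].
have ba d (T : measurableType d) (g : T -> RR * RR * RR) :
    measurable_fun [set: T] g -> bounded_measurable (fun t => centered (g t)).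
  by move=> mg; apply: bmc => //; exact: bm_centered.
(* [int Z(w, u)^2 du = int int_(V * V) kernel(w, v, v') dv dv']. *)
have Z2 : Rintegral ((unif R) \x (unif R))%E [set: RR * RR]
    (fun z => Z z.1 z.2 ^+ 2) <= 0.
  have bZ2 : bounded_measurable (fun z : RR * RR => Z z.1 z.2 ^+ 2) by exact: bmM.
  rewrite bm_prod_Rintegral//=.
  pose phi (y : RR * RR * RR) : R := \1_V y.1.2 * \1_V y.2.
  have bphi : bounded_measurable phi.
    by apply: bmM; apply: bIc => //; measurable_coords.
  have := L2_null_orthogonal bm_kernel bphi kernel0.
  rewrite unif3_Rintegral; last by apply: bmM => //; exact: bm_kernel.
  move=> K0; rewrite le_eqVlt; apply/orP; left; apply/eqP; rewrite -[RHS]K0.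
  apply: eq_Rintegral => w _.
  transitivity (\int (fun u => \int (fun v => \int (fun v' =>
      centered (w, u, v) * \1_V v * (centered (w, u, v') * \1_V v'))))).
    apply: eq_Rintegral => u _.
    have bcu : bounded_measurable (fun v : RR => centered (w, u, v) * \1_V v).
      apply: bmM; last by apply: bIc.
      by apply: ba; apply: measurable_fun_pair.
    under eq_Rintegral do rewrite bm_RintegralZl//.
    rewrite expr2 /Z -bm_RintegralZl//.
    by apply: eq_Rintegral => v _; rewrite mulrC.
  have b4 : bounded_measurable (fun z : RR * RR * RR =>
      centered (w, z.1.1, z.1.2) * \1_V z.1.2 *
      (centered (w, z.1.1, z.2) * \1_V z.2)).
    have mw : measurable_fun [set: RR * RR * RR] (fun=> w) by exact: measurable_cst.
    apply: bmM; (apply: bmM; [apply: ba|by apply: bIc => //; measurable_coords]);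
    by apply: measurable_fun_pair; [apply: measurable_fun_pair => //|]; measurable_coords.
  (* Two exchanges of integrals bring [u] innermost, where [kernelE] applies. *)
  rewrite (bm_Fubini (unif R) (unif R) (f := fun uv : RR * RR => \int (fun v' =>
      centered (w, uv.1, uv.2) * \1_V uv.2 *
      (centered (w, uv.1, v') * \1_V v')))); last first.
    exact: (bm_fubini (unif R) b4).
  apply: eq_Rintegral => v _ /=.
  rewrite (bm_Fubini (unif R) (unif R) (f := fun uv : RR * RR =>
      centered (w, uv.1, v) * \1_V v *
      (centered (w, uv.1, uv.2) * \1_V uv.2))); last first.
    apply: (bm_comp b4 (g := fun uv : RR * RR => (uv.1, v, uv.2))).
    by do 2 apply: measurable_fun_pair => //.
  apply: eq_Rintegral => v' _ /=.
  rewrite kernelE mulrC -bm_RintegralZl//.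
    by apply: eq_Rintegral => u _; rewrite /phi/=; ring.
  by apply: bmM; apply: ba; do 2 apply: measurable_fun_pair => //.
pose h (z : RR * RR) : R := \1_W z.1 * \1_U z.2.
have bh : bounded_measurable h.
  by apply: bmM; apply: bIc => //; measurable_coords.
have := L2_null_orthogonal bZ bh Z2.
have bZh : bounded_measurable (fun z : RR * RR => Z z.1 z.2 * h z) by exact: bmM.
rewrite bm_prod_Rintegral//= => <-.
rewrite unif3_Rintegral; last first.
  apply: bmM; first exact: bm_centered.
  by apply: bmM; [apply: bmM|]; apply: bIc => //; measurable_coords.
apply: eq_Rintegral => w _; apply: eq_Rintegral => u _ /=.
rewrite [RHS]mulrC /Z -bm_RintegralZl//.
  by apply: eq_Rintegral => v _; rewrite /h/=; ring.
apply: bmM; last by apply: bIc.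
by apply: ba; apply: measurable_fun_pair.
Qed.

Definition boxes : set (set (RR * RR * RR)) :=
  [set A | exists W U V : set RR, [/\ measurable W, measurable U, measurable V &
           A = W `*` U `*` V]].

(** The nontrivial inclusion says that the identity out of the space generated by the boxes is
    measurable, which is checked on its three coordinates. *)
Lemma measurable_boxes : measurable = <<s boxes >>.
Proof.
apply/seteqP; split; last first.
  apply: smallest_sub; first exact: sigma_algebra_measurable.
  move=> _ [W [U [V [mW mU mV ->]]]].
  by apply: measurableX => //; exact: measurableX.
pose T3 := g_sigma_algebraType boxes.
have mbox W U V : measurable W -> measurable U -> measurable V ->
    <<s boxes >> (W `*` U `*` V).
  by move=> mW mU mV; apply: sub_sigma_algebra; exists W, U, V.
have m1 : measurable_fun [set: T3] (fun y : T3 => y.1.1 : RR).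
  move=> _ A mA; rewrite setTI.
  rewrite (_ : _ @^-1` A = A `*` setT `*` setT); first exact: mbox.
  by apply/seteqP; split => y /=; [|move=> [[]]].
have m2 : measurable_fun [set: T3] (fun y : T3 => y.1.2 : RR).
  move=> _ A mA; rewrite setTI.
  rewrite (_ : _ @^-1` A = setT `*` A `*` setT); first exact: mbox.
  by apply/seteqP; split => y /=; [|move=> [[]]].
have m3 : measurable_fun [set: T3] (fun y : T3 => y.2 : RR).
  move=> _ A mA; rewrite setTI.
  rewrite (_ : _ @^-1` A = setT `*` setT `*` A); first exact: mbox.
  by apply/seteqP; split => y /=; [|move=> [[]]].
have mid : measurable_fun [set: T3] (fun y : T3 => (y.1.1, y.1.2, y.2) : RR * RR * RR).
  by do 2 apply: measurable_fun_pair => //.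
move=> A mA; have := mid measurableT A mA; rewrite setTI.
congr (<<s boxes >> _).
by apply/seteqP; split => -[[w u] v].
Qed.

Lemma centered_ae0 : unif3 R [set y | B y != mean_u y.1.1 y.2] = 0%E.
Proof.
have bE : bounded_measurable (fun y : RR * RR * RR => mean_u y.1.1 y.2).
  apply: (bm_comp (g := fun y : RR * RR * RR => (y.1.1, y.2)) bm_mean_u).
  by measurable_coords.
apply: (eq_density (C := boxes)) => //.
- exact: measurable_boxes.
- move=> _ _ [W [U [V [mW mU mV ->]]]] [W' [U' [V' [mW' mU' mV' ->]]]].
  exists (W `&` W'), (U `&` U'), (V `&` V'); split; try exact: measurableI.
  by rewrite !setXI.
- by exists setT, setT, setT; split => //; rewrite !setXTT.
move=> _ [W [U [V [mW mU mV ->]]]].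
have mA : measurable (W `*` U `*` V).
  by apply: measurableX => //; exact: measurableX.
apply/eqP; rewrite -subr_eq0 -RintegralB//; [|exact: bm_integrable..].
apply/eqP; rewrite -[RHS](box_centered mW mU mV) Rintegral_mkcond.
apply: eq_Rintegral => -[[w u] v] _.
rewrite patchE !in_setX/= /centered/= !indicE.
by case: (w \in W); case: (u \in U); case: (v \in V); rewrite /= ?(mulr1, mulr0).
Qed.

End Decorrelation.

(** * From the spins to the averaged function *)

Section Transfer.
Context d d' (T : measurableType d) (T' : measurableType d') (R : realType).
Variables (P : probability T R) (P' : probability T' R).
Variables (p : nat) (alpha : R) (D : disorder P p) (X : thermal P').
Variable sigma : R * R * R * R -> R.
Hypothesis D_law : disorder_law alpha D.
Hypothesis X_law : thermal_law X.
Hypothesis sign_sigma : sign_function sigma.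

Local Notation RR := (measurableTypeR R).
Local Notation lab2 := (@standard_label 2).
Local Notation tau := (sign_bit sigma).
Local Notation "'\int' f" := (Rintegral (unif R) [set: RR] f) (at level 36).

Definition sign_at (y : RR * RR * RR * RR) : R := (-1) ^+ tau y.

Lemma bm_sign_tau : bounded_measurable (fun y : R * R * R * R => (-1) ^+ tau y : R).
Proof.
exact: (bm_bool (fun b : bool => (-1) ^+ b : R) (measurable_sign_bit sign_sigma)).
Qed.

Lemma bm_sign_at : bounded_measurable sign_at.
Proof.
apply: (bm_comp bm_sign_tau (g := fun y : RR * RR * RR * RR => y : R * R * R * R)).
have -> : (fun y : RR * RR * RR * RR => y : R * R * R * R) =
    (fun y => (y.1.1.1 : R, y.1.1.2 : R, y.1.2 : R, y.2 : R)).
  by apply: funext => -[[[w u] v] x].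
have idR d0 (U : measurableType d0) (g : U -> RR) : measurable_fun [set: U] g ->
    measurable_fun [set: U] (fun y => g y : R).
  by move=> mg _ A mA; exact: (mg measurableT A mA).
by do 3 try apply: measurable_fun_pair; apply: idR; measurable_coords.
Qed.

(** A version of [sigma_bar] that is bounded and measurable on the whole space; the two agree on the
    unit cube. *)
Definition bar (y : RR * RR * RR) : R := \int (fun x => sign_at (y, x)).

Lemma bm_bar : bounded_measurable bar.
Proof. exact: (bm_fubini (unif R) bm_sign_at). Qed.

Lemma thermal_law3 (F : 3.-tuple R -> R) : bounded_measurable F ->
  Rintegral P' [set: T'] (fun t' => F (thermal_point X lab2 t')) =
  \int (fun u => \int (fun x => \int (fun x' => F [tuple u : R; x : R; x' : R]))).
Proof.
move=> bF; rewrite (uniform3_law _ _ bF); first last.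
- move=> B mB; apply: thermal_rectangle => //.
  by move=> i j [/val_inj].
- exact: measurable_thermal_point.
by rewrite unif3_Rintegral//; apply: (bm_comp bF); exact: measurable_tuple3.
Qed.

Let cov_at (z : 3.-tuple R) : R :=
  kernel bar (tnth z (@Ordinal 3 0 isT) : RR, tnth z (@Ordinal 3 1 isT) : RR,
              tnth z (@Ordinal 3 2 isT) : RR).

(** The two spins share [u] but have independent variables [x]; integrating the latter out replaces
    each spin by [bar] and leaves a covariance in [u]. *)
Lemma covariance_at_kernel t : covariance_at D X sigma t =
  kernel bar (dis_w D t : RR, dis_v D [:: 0%N] t : RR, dis_v D [:: 1%N] t : RR).
Proof.
set w := dis_w D t; set v0 := dis_v D [:: 0%N] t; set v1 := dis_v D [:: 1%N] t.
pose c0 : 'I_3 := @Ordinal 3 0 isT. pose c1 : 'I_3 := @Ordinal 3 1 isT.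
pose c2 : 'I_3 := @Ordinal 3 2 isT.
pose f0 (z : 3.-tuple R) : R := (-1) ^+ tau (w, tnth z c0, v0, tnth z c1).
pose f1 (z : 3.-tuple R) : R := (-1) ^+ tau (w, tnth z c0, v1, tnth z c2).
have bf v (c : 'I_3) : bounded_measurable (fun z : 3.-tuple R =>
    (-1) ^+ tau (w, tnth z c0, v, tnth z c) : R).
  apply: (bm_comp bm_sign_tau (g := fun z : 3.-tuple R => (w, tnth z c0, v, tnth z c))).
  apply: measurable_fun_pair; last exact: measurable_tnth.
  apply: measurable_fun_pair => //; apply: measurable_fun_pair => //.
  exact: measurable_tnth.
have th0 t' : tnth (thermal_point X lab2 t') c0 = th_u X t'.
  by rewrite tnth_mktuple /thermal_coord (_ : c0 = ord0) ?unlift_none//; exact: val_inj.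
have th1 t' : tnth (thermal_point X lab2 t') c1 = th_x X [:: 0%N] t'.
  rewrite tnth_mktuple /thermal_coord (_ : c1 = lift ord0 (ord0 : 'I_2)) ?liftK//.
  exact: val_inj.
have th2 t' : tnth (thermal_point X lab2 t') c2 = th_x X [:: 1%N] t'.
  rewrite tnth_mktuple /thermal_coord (_ : c2 = lift ord0 (ord_max : 'I_2)) ?liftK//.
  exact: val_inj.
have sp0 t' : spin D X sigma [:: 0%N] t t' = f0 (thermal_point X lab2 t').
  by rewrite (spinE D_law X_law sign_sigma) /f0 th0 th1.
have sp1 t' : spin D X sigma [:: 1%N] t t' = f1 (thermal_point X lab2 t').
  by rewrite (spinE D_law X_law sign_sigma) /f1 th0 th2.
have bs (u v : RR) : bounded_measurable (fun x : RR => sign_at (w : RR, u, v, x)).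
  apply: (bm_comp bm_sign_at (g := fun x : RR => (w : RR, u, v, x))).
  exact: measurable_fun_pair.
have E0 : E' P' (fun t' => spin D X sigma [:: 0%N] t t') = mean_u bar w v0.
  rewrite /E'; under eq_Rintegral do rewrite sp0.
  rewrite thermal_law3; last exact: bf.
  apply: eq_Rintegral => u _; apply: eq_Rintegral => x _.
  by rewrite -[RHS](@probability_Rintegral_cst _ _ _ (unif R)).
have E1 : E' P' (fun t' => spin D X sigma [:: 1%N] t t') = mean_u bar w v1.
  rewrite /E'; under eq_Rintegral do rewrite sp1.
  rewrite thermal_law3; last exact: bf.
  apply: eq_Rintegral => u _.
  by rewrite -[RHS](@probability_Rintegral_cst _ _ _ (unif R)).
have E01 : E' P' (fun t' => spin D X sigma [:: 0%N] t t' * spin D X sigma [:: 1%N] t t') =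
    \int (fun u => bar (w : RR, u, v0 : RR) * bar (w : RR, u, v1 : RR)).
  rewrite /E'; under eq_Rintegral do rewrite sp0 sp1.
  rewrite (thermal_law3 (F := fun z => f0 z * f1 z)); last by apply: bmM; exact: bf.
  apply: eq_Rintegral => u _.
  rewrite [in RHS]/bar mulrC -bm_RintegralZl//.
  apply: eq_Rintegral => x _; rewrite mulrC -bm_RintegralZl//.
by rewrite /covariance_at E0 E1 E01.
Qed.

(** [w] and the two variables [v] are i.i.d. uniform, so the expectation over the disorder is an
    integral over the cube. *)
Lemma kernel_bar_eq0 :
  Rintegral P [set: T] (fun t => covariance_at D X sigma t ^+ 2) <= 0 ->
  Rintegral (unif3 R) [set: RR * RR * RR] (fun y => kernel bar y ^+ 2) <= 0.
Proof.
move=> cov0; apply: le_trans cov0; rewrite le_eqVlt; apply/orP; left; apply/eqP.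
have bk : bounded_measurable (fun z => cov_at z ^+ 2).
  have bk1 : bounded_measurable cov_at.
    apply: (bm_comp (bm_kernel bm_bar) (g := fun z : 3.-tuple R =>
      (tnth z (@Ordinal 3 0 isT) : RR, tnth z (@Ordinal 3 1 isT) : RR,
       tnth z (@Ordinal 3 2 isT) : RR))).
    have mt (c : 'I_3) : measurable_fun [set: 3.-tuple R] (fun z => tnth z c : RR).
      by move=> _ A mA; exact: (measurable_tnth c measurableT mA).
    by do 2 apply: measurable_fun_pair => //.
  exact: bmM.
have labI : injective lab2 by move=> i j [/val_inj].
have H := uniform3_law (P := P) (measurable_disorder_point D lab2) _ bk.
transitivity (Rintegral (unif3 R) [set: RR * RR * RR]
    (fun y => cov_at [tuple y.1.1 : R; y.1.2 : R; y.2 : R] ^+ 2)).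
  by apply: eq_Rintegral => -[[w v] v'] _.
rewrite -H; last first.
  move=> B mB.
  have := disorder_rectangle (law_v D_law) (law_w D_law) (disorder_indep D_law)
    (environment_eventT D) labI mB.
  by rewrite setTI probability_setT mul1r.
apply: eq_Rintegral => t _; congr (_ ^+ 2).
rewrite covariance_at_kernel /cov_at !tnth_mktuple /disorder_coord.
rewrite (_ : @Ordinal 3 0 isT = ord0); last exact: val_inj.
rewrite (_ : @Ordinal 3 1 isT = lift ord0 (ord0 : 'I_2)); last exact: val_inj.
rewrite (_ : @Ordinal 3 2 isT = lift ord0 (ord_max : 'I_2)); last exact: val_inj.
by rewrite unlift_none !liftK.
Qed.

Lemma sigma_bar_bar (w u v : R) : 0 <= w <= 1 -> 0 <= u <= 1 -> 0 <= v <= 1 ->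
  sigma_bar sigma w u v = bar (w : RR, u : RR, v : RR).
Proof.
move=> w01 u01 v01; rewrite /bar unif_Rintegral.
  apply: eq_Rintegral => x; rewrite inE/= in_itv/= => x01.
  by rewrite sign_bitE.
apply: (bm_comp bm_sign_at (g := fun x : RR => (w : RR, u : RR, v : RR, x))).
exact: measurable_fun_pair.
Qed.

Lemma mean_sigma_bar (w v : R) : 0 <= w <= 1 -> 0 <= v <= 1 ->
  Rintegral lebesgue_measure `[0, 1]%classic (fun u => sigma_bar sigma w u v) =
  mean_u bar w v.
Proof.
move=> w01 v01; rewrite /mean_u unif_Rintegral.
  apply: eq_Rintegral => u; rewrite inE/= in_itv/= => u01.
  by rewrite sigma_bar_bar.
apply: (bm_comp bm_bar (g := fun u : RR => (w : RR, u, v : RR))).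
by do 2 apply: measurable_fun_pair => //.
Qed.

End Transfer.

(** * The smallness condition and the almost everywhere identity *)

Theorem theorem5 (R : realType) (d d' : measure_display)
    (T : measurableType d) (T' : measurableType d')
    (P : probability T R) (P' : probability T' R)
    (p : nat) (alpha beta : R)
    (D : disorder P p) (X : thermal P')
    (mu : probability (array_space R) R) (sigma : R * R * R * R -> R) :
  (2 <= p)%N -> 0 < alpha -> 0 < beta ->
  Num.min (4 * beta) 1 * (p%:R - 1) * p%:R * alpha < 1 ->
  disorder_law alpha D -> thermal_law X ->
  M_inv beta D X mu -> corresponding beta D X sigma mu ->
  {ae ((lebesgue_measure \x lebesgue_measure) \x lebesgue_measure)%E,
    forall y : R * R * R,
      0 <= y.1.1 <= 1 -> 0 <= y.1.2 <= 1 -> 0 <= y.2 <= 1 ->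
      sigma_bar sigma y.1.1 y.1.2 y.2 =
      Rintegral lebesgue_measure `[0, 1]
        (fun u' => sigma_bar sigma y.1.1 u' y.2)}.
Proof.
move=> p2 alpha0 beta0 small Dl Xl _ [sg _ cav].
have p0 : (0 < p)%N by exact: ltn_trans p2.
have branching1 : branching p alpha beta < 1.
  have pE : p.-1%:R = p%:R - 1 :> R by rewrite -subn1 natrB.
  apply: le_lt_trans small; rewrite /branching pE.
  rewrite (_ : Num.min (4 * beta) 1 * (p%:R - 1) * p%:R * alpha =
    Num.min (4 * beta) 1 * ((p%:R - 1) * (alpha * p%:R))); last by ring.
  have p10 : 0 <= p%:R - 1 :> R by rewrite -pE.
  rewrite ler_wpM2r ?mulr_ge0 ?(ltW alpha0)//.
  have e2 : expR (- beta) ^+ 2 = expR (- (2 * beta)).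
    by rewrite expr2 -expRD; congr expR; ring.
  (* [1 - expR (- (2 * beta))] is at most [2 * beta], hence at most [4 * beta], and less than 1;
     this is how [branching] compares with the smallness condition. *)
  have e1 : 1 - 2 * beta <= expR (- (2 * beta)) by exact: expR_ge1Dx.
  have e0 := expR_gt0 (- (2 * beta)).
  by rewrite le_min e2; apply/andP; split; lra.
have cov0 := covariance_at_eq0 p0 alpha0 beta0 Dl Xl sg cav branching1.
have ker0 := kernel_bar_eq0 Dl Xl sg cov0.
have N0 := centered_ae0 (bm_bar sg) ker0.
pose RR := measurableTypeR R.
have bE : bounded_measurable (fun y : RR * RR * RR => mean_u (bar sigma) y.1.1 y.2).
  apply: (bm_comp (g := fun y : RR * RR * RR => (y.1.1, y.2)) (bm_mean_u (bm_bar sg))).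
  by measurable_coords.
have mN : measurable [set y | bar sigma y != mean_u (bar sigma) y.1.1 y.2].
  rewrite (_ : [set y | _] =
      (fun y => bar sigma y == mean_u (bar sigma) y.1.1 y.2) @^-1` [set false]).
    rewrite -[X in measurable X]setTI; apply: measurable_fun_eqr => //.
      by case: (bm_bar sg).
    by case: bE.
  by apply/seteqP; split => y /=; [move=> /negbTE|move=> /negbT].
(* Outside the cube the claim is void, so the exceptional set lies in the part of the null set
   inside the cube. *)
apply: negligibleS (negligible_cube mN N0) => -[[w u] v] /= H.
move/not_implyP: H => [w01 /not_implyP[u01 /not_implyP[v01 H]]].
split => //; apply/eqP => E; apply: H.
by rewrite sigma_bar_bar// mean_sigma_bar.
Qed.
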